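(* Let $V$ be a complex Hilbert space and let $g \in \mathrm{Sp}(V)$. Let $Z : V_{\mathbf{C}} \to V_{\mathbf{C}}$ be the (symmetric antilinear) map given by the rule that for $v \in V$ $$Z(v_{+}) = (C_g^{-1}v)_{-} + (Z_{g^{-1}}v)_{+}, \qquad Z(v_{-}) = (C_{g^{-1}}^{-1}v)_{+} + (Z_g v)_{-}.$$ Then the linear map $U_g : SV \to SV'$ with kernel $u_g = e^{Z} \in SV_{\mathbf{C}}'$, that is, $$[U_g\phi](\psi) = e^{Z}(\psi_{+}\phi_{-}) \qquad (\phi,\psi\in SV),$$ is a weak metaplectic operator for $g$.
   Context: Inner products are antilinear in the first slot and linear in the second. For a complex Hilbert space $W$, $SW = \bigoplus_{n\ge0}S^nW$ is the (algebraic) symmetric algebra and $SW'$ is the full antidual, i.e. all antilinear functionals $SW\to\mathbf{C}$. $SW'$ is a commutative algebra under $[\Phi\Psi](\theta) = [\Phi\otimes\Psi](\Delta\theta)$, where $\Delta: SW\to SW\otimes SW$ is the algebra homomorphism with $\Delta w = w\otimes 1 + 1\otimes w$ for $w\in W$. Creators and annihilators: for $v\in W$, on $SW$, $c(v)\phi = v\phi$ and $a(v)$ is the linear derivation with $a(v)\mathbf{1}=0$ and $a(v)w = \langle v|w\rangle \mathbf{1}$ for $w\in W$. They act on $SW'$ by $[c(v)\Phi](\psi) = \Phi(a(v)\psi)$ and $[a(v)\Phi](\psi)=\Phi(c(v)\psi)$. Put $\pi(v) = \frac{1}{\sqrt2}(c(v)+a(v))$ on $SW$ and on $SW'$. Gaussians: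 let $Z: W\to W$ be antilinear and symmetric, meaning $\langle y|Zx\rangle = \langle x|Zy\rangle$ for all $x,y\in W$. Let $\zeta\in SW'$ be the functional vanishing on $S^nW$ for $n\ne2$ with $\zeta(xy)=\langle y|Zx\rangle$ for $x,y\in W$. Then $e^Z = \sum_{n\ge0}\frac{1}{n!}\zeta^n\in SW'$ (pointwise convergent on $SW$). Complexification: let $J$ be multiplication by $i$ on $V$ (as a real-linear operator) and $\Omega=\mathrm{Im}\langle\cdot|\cdot\rangle$. Let $V_{\mathbf{C}}=\mathbf{C}\otimes_{\mathbf{R}}V$ with canonical conjugation $\bar{\cdot}$ and inner product $\langle x|y\rangle=\Omega_{\mathbf{C}}(\bar x,J_{\mathbf{C}}y)$, where $J_{\mathbf{C}},\Omega_{\mathbf{C}}$ are the complex-(bi)linear extensions. Then $V_{\mathbf{C}}=V_+\oplus V_-$ orthogonally, with $J_{\mathbf{C}}=\pm iI$ on $V_\pm$. For $v\in V$, $v_{+}=\frac{1}{\sqrt2}(v-iJv)\in V_+$ and $v_{-}=\frac{1}{\sqrt2}(v+iJv)\in V_-$; these are respectively a linear isometry $V\to V_+$ and an antilinear isometry $V\to V_-$, both onto. They extend to a linear multiplicative bijection $\psi\mapsto\psi_+$, $SV\to S(V_+)\subset SV_{\mathbf{C}}$, and an antilinear multiplicative bijection $\phi\mapsto\phi_-$, $SV\to S(V_-)\subset SV_{\mathbf{C}}$. Symplectics: $\mathrm{Sp}(V)$ is the group of all real-linear automorphisms $g$ of $V$ with $\Omega(gx,gy)=\Omega(x,y)$ for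 all $x,y\in V$. Put $C_g=\frac12(g-JgJ)$ (complex-linear part) and $A_g=\frac12(g+JgJ)$ (antilinear part). It is known that $C_g$ is invertible and that $Z_g=C_g^{-1}A_g=-A_{g^{-1}}C_{g^{-1}}^{-1}$ is a symmetric antilinear operator of operator norm strictly less than $1$. Weak metaplectic operator for $g$: a nonzero linear map $U:SV\to SV'$ such that $U\pi(v)=\pi(gv)U$ for all $v\in V$ (with $\pi(v)$ acting on $SV$ and $\pi(gv)$ on $SV'$); equivalently, $Uc(v)=\{c(C_gv)+a(A_gv)\}U$ and $Ua(v)=\{c(A_gv)+a(C_gv)\}U$ for all $v\in V$. *)

(* Defs.v *)
From HB Require Import structures.
From mathcomp Require Import all_boot all_order all_algebra.
From mathcomp Require Import ring complex.
From mathcomp Require Import boolp classical_sets functions reals.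
From mathcomp Require Import topology normedtype sequences.

Set Implicit Arguments.
Unset Strict Implicit.
Unset Printing Implicit Defensive.

Import Order.TTheory GRing.Theory Num.Theory.
Import numFieldNormedType.Exports.

Local Open Scope ring_scope.
Local Open Scope complex_scope.
Local Open Scope classical_set_scope.
Local Open Scope quotient_scope.

Local Notation "z ^*" := (conjc z) : ring_scope.

(* The symmetric algebra of a K-module W, as the commutative K-algebra
   presented by one generator for each w in W, subject to the relations that
   make the map W -> sym W linear. *)
Section SymmetricAlgebra.
Variables (K : comNzRingType) (W : lmodType K).

Inductive sym_expr : Type :=
| SymC of K
| SymG of W
| SymD of sym_expr & sym_expr
| SymM of sym_expr & sym_expr.

Inductive sym_eq : sym_expr -> sym_expr -> Prop :=
| sym_eq_refl x : sym_eq x x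
| sym_eq_sym x y : sym_eq x y -> sym_eq y x
| sym_eq_trans x y z : sym_eq x y -> sym_eq y z -> sym_eq x z
| sym_eqD x x' y y' :
    sym_eq x x' -> sym_eq y y' -> sym_eq (SymD x y) (SymD x' y')
| sym_eqM x x' y y' :
    sym_eq x x' -> sym_eq y y' -> sym_eq (SymM x y) (SymM x' y')
| sym_eqDA x y z : sym_eq (SymD x (SymD y z)) (SymD (SymD x y) z)
| sym_eqDC x y : sym_eq (SymD x y) (SymD y x)
| sym_eqD0 x : sym_eq (SymD (SymC 0) x) x
| sym_eqMA x y z : sym_eq (SymM x (SymM y z)) (SymM (SymM x y) z)
| sym_eqMC x y : sym_eq (SymM x y) (SymM y x)
| sym_eqM1 x : sym_eq (SymM (SymC 1) x) x
| sym_eqM0 x : sym_eq (SymM (SymC 0) x) (SymC 0)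
| sym_eqMD x y z : sym_eq (SymM (SymD x y) z) (SymD (SymM x z) (SymM y z))
| sym_eqCD a b : sym_eq (SymC (a + b)) (SymD (SymC a) (SymC b))
| sym_eqCM a b : sym_eq (SymC (a * b)) (SymM (SymC a) (SymC b))
| sym_eqGD v w : sym_eq (SymG (v + w)) (SymD (SymG v) (SymG w))
| sym_eqGZ a w : sym_eq (SymG (a *: w)) (SymM (SymC a) (SymG w)).

Definition sym_eqb : rel {classic sym_expr} := fun x y => `[< sym_eq x y >].

Fact sym_eqb_refl : reflexive sym_eqb.
Proof. by move=> x; apply/asboolP; exact: sym_eq_refl. Qed.
Fact sym_eqb_sym : symmetric sym_eqb.
Proof. by move=> x y; apply/asboolP/asboolP; exact: sym_eq_sym. Qed.
Fact sym_eqb_trans : transitive sym_eqb.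
Proof.
by move=> y x z /asboolP h /asboolP h'; apply/asboolP; exact: sym_eq_trans h h'.
Qed.

Canonical sym_equiv := EquivRel sym_eqb sym_eqb_refl sym_eqb_sym sym_eqb_trans.

Definition sym : Type := {eq_quot sym_equiv}.
HB.instance Definition _ := Choice.on sym.

Definition sym_class (x : sym_expr) : sym :=
  \pi_{eq_quot sym_equiv} (x : {classic sym_expr}).
Definition sym_repr (s : sym) : sym_expr := repr (s : {eq_quot sym_equiv}).

Lemma sym_reprK s : sym_class (sym_repr s) = s.
Proof. exact: reprK. Qed.

Lemma sym_class_eq x y : sym_class x = sym_class y <-> sym_eq x y.
Proof.
split; first by move=> /eqmodP/asboolP.
by move=> h; apply/eqmodP/asboolP.
Qed.

Lemma sym_repr_class x : sym_eq (sym_repr (sym_class x)) x.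
Proof. by apply/sym_class_eq; rewrite sym_reprK. Qed.

Definition sym_add (s t : sym) := sym_class (SymD (sym_repr s) (sym_repr t)).
Definition sym_mul (s t : sym) := sym_class (SymM (sym_repr s) (sym_repr t)).
Definition sym_scale (a : K) (s : sym) := sym_mul (sym_class (SymC a)) s.

Lemma sym_addE x y :
  sym_add (sym_class x) (sym_class y) = sym_class (SymD x y).
Proof. by apply/sym_class_eq; apply: sym_eqD; exact: sym_repr_class. Qed.

Lemma sym_mulE x y :
  sym_mul (sym_class x) (sym_class y) = sym_class (SymM x y).
Proof. by apply/sym_class_eq; apply: sym_eqM; exact: sym_repr_class. Qed.

Local Ltac sym_lift :=
  repeat (let s := fresh in move=> s; rewrite -(sym_reprK s));
  rewrite ?(sym_addE, sym_mulE); apply/sym_class_eq.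

Fact sym_addA : associative sym_add.
Proof. by sym_lift; constructor. Qed.
Fact sym_addC : commutative sym_add.
Proof. by sym_lift; constructor. Qed.
Fact sym_add0 : left_id (sym_class (SymC 0)) sym_add.
Proof. by sym_lift; constructor. Qed.
Fact sym_mulA : associative sym_mul.
Proof. by sym_lift; constructor. Qed.
Fact sym_mulC : commutative sym_mul.
Proof. by sym_lift; constructor. Qed.
Fact sym_mul1 : left_id (sym_class (SymC 1)) sym_mul.
Proof. by sym_lift; constructor. Qed.
Fact sym_mulD : left_distributive sym_mul sym_add.
Proof. by sym_lift; constructor. Qed.
Fact sym_addN : left_inverse (sym_class (SymC 0)) (sym_scale (- 1)) sym_add.
Proof.
move=> s; rewrite -(sym_reprK s) /sym_scale sym_mulE sym_addE.
apply/sym_class_eq; set x := sym_repr s.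
apply: (@sym_eq_trans _ (SymD (SymM (SymC (-1)) x) (SymM (SymC 1) x))).
  by apply: sym_eqD; [exact: sym_eq_refl | apply: sym_eq_sym; exact: sym_eqM1].
apply: (@sym_eq_trans _ (SymM (SymD (SymC (-1)) (SymC 1)) x)).
  by apply: sym_eq_sym; exact: sym_eqMD.
apply: (@sym_eq_trans _ (SymM (SymC (- 1 + 1)) x)).
  apply: sym_eqM; last exact: sym_eq_refl.
  by apply: sym_eq_sym; exact: sym_eqCD.
by rewrite addNr; exact: sym_eqM0.
Qed.

HB.instance Definition _ :=
  GRing.isZmodule.Build sym sym_addA sym_addC sym_add0 sym_addN.

Fixpoint sym_counit (x : sym_expr) : K :=
  match x with
  | SymC a => a
  | SymG _ => 0
  | SymD x y => sym_counit x + sym_counit y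
  | SymM x y => sym_counit x * sym_counit y
  end.

Fact sym_one_neq0 : sym_class (SymC 1) != 0.
Proof.
apply/eqP => /sym_class_eq h.
suff /(_ _ _ h)/= /eqP : forall x y, sym_eq x y -> sym_counit x = sym_counit y.
  by rewrite oner_eq0.
move=> x y; elim=> //=.
- by move=> ? ? ? _ -> _ ->.
- by move=> ? ? ? ? _ -> _ ->.
- by move=> ? ? ? ? _ -> _ ->.
- by move=> *; rewrite addrA.
- by move=> *; rewrite addrC.
- by move=> *; rewrite add0r.
- by move=> *; rewrite mulrA.
- by move=> *; rewrite mulrC.
- by move=> *; rewrite mul1r.
- by move=> *; rewrite mul0r.
- by move=> *; rewrite mulrDl.
- by rewrite addr0.
- by move=> *; rewrite mulr0.
Qed.

HB.instance Definition _ := GRing.Zmodule_isComNzRing.Build sym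
  sym_mulA sym_mulC sym_mul1 sym_mulD sym_one_neq0.

Fact sym_scaleA a b (s : sym) :
  sym_scale a (sym_scale b s) = sym_scale (a * b) s.
Proof.
rewrite /sym_scale sym_mulA sym_mulE; congr sym_mul.
by apply/sym_class_eq; apply: sym_eq_sym; exact: sym_eqCM.
Qed.
Fact sym_scale1 : left_id 1 sym_scale.
Proof. exact: sym_mul1. Qed.
Fact sym_scaleDr : right_distributive sym_scale (+%R : sym -> sym -> sym).
Proof.
move=> a s t; rewrite /sym_scale (sym_mulC _ (s + t)) (sym_mulC _ s) (sym_mulC _ t).
exact: sym_mulD.
Qed.
Fact sym_scaleDl (s : sym) : {morph sym_scale^~ s : a b / a + b}.
Proof.
move=> a b; rewrite /sym_scale -[RHS]sym_mulD sym_addE; congr sym_mul.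
by apply/sym_class_eq; exact: sym_eqCD.
Qed.

HB.instance Definition _ := GRing.Zmodule_isLmodule.Build K sym
  sym_scaleA sym_scale1 sym_scaleDr sym_scaleDl.

Fact sym_scaleAl (a : K) (s t : sym) : a *: (s * t) = a *: s * t.
Proof. exact: sym_mulA. Qed.
HB.instance Definition _ := GRing.Lmodule_isLalgebra.Build K sym sym_scaleAl.
Fact sym_scaleAr (a : K) (s t : sym) : a *: (s * t) = s * (a *: t).
Proof. by rewrite mulrC sym_scaleAl mulrC. Qed.
HB.instance Definition _ := GRing.Lalgebra_isAlgebra.Build K sym sym_scaleAr.

Definition sym_in (w : W) : sym := sym_class (SymG w).

Fact sym_in_linear : linear sym_in.
Proof.
move=> a v w; rewrite /sym_in.
transitivity (sym_class (SymD (SymG (a *: v)) (SymG w))).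
  by apply/sym_class_eq; exact: sym_eqGD.
rewrite -sym_addE; congr sym_add.
transitivity (sym_class (SymM (SymC a) (SymG v))).
  by apply/sym_class_eq; exact: sym_eqGZ.
by rewrite -sym_mulE.
Qed.
HB.instance Definition _ := GRing.isLinear.Build K W sym *:%R sym_in sym_in_linear.

Lemma sym_classC a : sym_class (SymC a) = a%:A.
Proof. by rewrite -[LHS]mulr1. Qed.
Lemma sym_classD x y : sym_class (SymD x y) = sym_class x + sym_class y.
Proof. by rewrite -sym_addE. Qed.
Lemma sym_classM x y : sym_class (SymM x y) = sym_class x * sym_class y.
Proof. by rewrite -sym_mulE. Qed.

Lemma sym_ind (P : sym -> Prop) :
  (forall a : K, P a%:A) -> (forall w, P (sym_in w)) ->
  (forall s t, P s -> P t -> P (s + t)) ->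
  (forall s t, P s -> P t -> P (s * t)) -> forall s, P s.
Proof.
move=> PC PG PD PM s; rewrite -(sym_reprK s).
elim: (sym_repr s) => [a|w|x Px y Py|x Px y Py].
- by rewrite sym_classC.
- exact: PG.
- by rewrite sym_classD; exact: PD.
- by rewrite sym_classM; exact: PM.
Qed.

(* S^n W, spanned by the n-fold products of elements of W *)
Definition sym_pow (n : nat) : set sym :=
  [set s | exists (k : nat) (a : 'I_k -> K) (ws : 'I_k -> n.-tuple W),
     s = \sum_i a i *: \prod_(w <- ws i) sym_in w].

End SymmetricAlgebra.

(* The multiplicative extension to sym W of a map f : W -> B which is
   semilinear along phi : K -> B. *)
Section Extension.
Variables (K : comNzRingType) (W : lmodType K) (B : comPzRingType).
Variables (phi : K -> B) (f : W -> B).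

Fixpoint sym_eval (x : sym_expr W) : B :=
  match x with
  | SymC a => phi a
  | SymG w => f w
  | SymD x y => sym_eval x + sym_eval y
  | SymM x y => sym_eval x * sym_eval y
  end.

Definition sym_ext (s : sym W) : B := sym_eval (sym_repr s).

End Extension.

Section ExtensionTheory.
Variables (K : comNzRingType) (W : lmodType K) (B : comPzRingType).
Variables (phi : {rmorphism K -> B}) (f : W -> B).
Hypothesis f_semilinear : forall a v w, f (a *: v + w) = phi a * f v + f w.

Lemma sym_eval_eq x y : sym_eq x y -> sym_eval phi f x = sym_eval phi f y.
Proof.
have f0 : f 0 = 0.
  have := f_semilinear 1 0 0; rewrite scale1r addr0 rmorph1 mul1r.
  by move/(congr1 (fun b => b - f 0)); rewrite addrK subrr.
elim=> //=.
- by move=> ? ? ? _ -> _ ->.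
- by move=> ? ? ? ? _ -> _ ->.
- by move=> ? ? ? ? _ -> _ ->.
- by move=> *; rewrite addrA.
- by move=> *; rewrite addrC.
- by move=> *; rewrite rmorph0 add0r.
- by move=> *; rewrite mulrA.
- by move=> *; rewrite mulrC.
- by move=> *; rewrite rmorph1 mul1r.
- by move=> *; rewrite rmorph0 mul0r.
- by move=> *; rewrite mulrDl.
- by move=> *; rewrite rmorphD.
- by move=> *; rewrite rmorphM.
- by move=> v w; rewrite -[v]scale1r f_semilinear rmorph1 mul1r scale1r.
- by move=> a w; rewrite -[_ *: _]addr0 f_semilinear f0 addr0.
Qed.

Lemma sym_ext_class x : sym_ext phi f (sym_class x) = sym_eval phi f x.
Proof. exact/sym_eval_eq/sym_repr_class. Qed.

Lemma sym_extA a : sym_ext phi f a%:A = phi a.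
Proof. by rewrite -sym_classC sym_ext_class. Qed.
Lemma sym_ext_in w : sym_ext phi f (sym_in w) = f w.
Proof. exact: sym_ext_class. Qed.
Lemma sym_extD s t : sym_ext phi f (s + t) = sym_ext phi f s + sym_ext phi f t.
Proof.
by rewrite -(sym_reprK s) -(sym_reprK t) -sym_classD !sym_ext_class.
Qed.
Lemma sym_extM s t : sym_ext phi f (s * t) = sym_ext phi f s * sym_ext phi f t.
Proof.
by rewrite -(sym_reprK s) -(sym_reprK t) -sym_classM !sym_ext_class.
Qed.
Lemma sym_extZ a s : sym_ext phi f (a *: s) = phi a * sym_ext phi f s.
Proof. by rewrite -mulr_algl sym_extM sym_extA. Qed.

End ExtensionTheory.

(* The derivation of sym W that vanishes on scalars and extends l. *)
Section Derivation.
Variables (K : comNzRingType) (W : lmodType K).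

Fixpoint sym_der_expr (l : W -> sym W) (x : sym_expr W) : sym W :=
  match x with
  | SymC _ => 0
  | SymG w => l w
  | SymD x y => sym_der_expr l x + sym_der_expr l y
  | SymM x y =>
      sym_der_expr l x * sym_class y + sym_class x * sym_der_expr l y
  end.

Definition sym_der (l : W -> sym W) (s : sym W) : sym W :=
  sym_der_expr l (sym_repr s).

Variable l : {linear W -> sym W}.

Lemma sym_der_expr_eq x y :
  sym_eq x y -> sym_der_expr l x = sym_der_expr l y.
Proof.
elim=> //=.
- by move=> ? ? ? _ -> _ ->.
- by move=> ? ? ? ? _ -> _ ->.
- by move=> ? ? ? ? /sym_class_eq -> -> /sym_class_eq -> ->.
- by move=> *; rewrite addrA.
- by move=> *; rewrite addrC.
- by move=> *; rewrite add0r.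
- by move=> x0 y0 z; rewrite !sym_classM mulrDl mulrDr !mulrA addrA.
- by move=> x0 y0; rewrite addrC; congr (_ + _); rewrite mulrC.
- by move=> x0; rewrite mul0r add0r sym_classC scale1r mul1r.
- by move=> x0; rewrite mul0r add0r sym_classC scale0r mul0r.
- by move=> x0 y0 z; rewrite !sym_classD !mulrDl addrACA.
- by move=> *; rewrite addr0.
- by move=> *; rewrite mul0r mulr0 addr0.
- by move=> *; rewrite linearD.
- by move=> a w; rewrite linearZ mul0r add0r sym_classC mulr_algl.
Qed.

Lemma sym_der_class x : sym_der l (sym_class x) = sym_der_expr l x.
Proof. exact/sym_der_expr_eq/sym_repr_class. Qed.

Lemma sym_derA a : sym_der l a%:A = 0.
Proof. by rewrite -sym_classC sym_der_class. Qed.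
Lemma sym_der1 : sym_der l 1 = 0.
Proof. by rewrite -(scale1r 1) sym_derA. Qed.
Lemma sym_der_in w : sym_der l (sym_in w) = l w.
Proof. exact: sym_der_class. Qed.
Lemma sym_derD s t : sym_der l (s + t) = sym_der l s + sym_der l t.
Proof.
by rewrite -(sym_reprK s) -(sym_reprK t) -sym_classD !sym_der_class.
Qed.
Lemma sym_derM s t : sym_der l (s * t) = sym_der l s * t + s * sym_der l t.
Proof.
by rewrite -(sym_reprK s) -(sym_reprK t) -sym_classM !sym_der_class.
Qed.
Lemma sym_derZ a s : sym_der l (a *: s) = a *: sym_der l s.
Proof. by rewrite -mulr_algl sym_derM sym_derA mul0r add0r mulr_algl. Qed.

End Derivation.

(* The tensor product of two K-modules, presented by the generators u (x) w
   and the bilinearity relations. *)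
Section TensorProduct.
Variables (K : comNzRingType) (U W : lmodType K).

Inductive tensor_expr : Type :=
| Tens0
| TensP of U & W
| TensD of tensor_expr & tensor_expr
| TensZ of K & tensor_expr.

Inductive tensor_eq : tensor_expr -> tensor_expr -> Prop :=
| tensor_eq_refl x : tensor_eq x x
| tensor_eq_sym x y : tensor_eq x y -> tensor_eq y x
| tensor_eq_trans x y z : tensor_eq x y -> tensor_eq y z -> tensor_eq x z
| tensor_eqD x x' y y' :
    tensor_eq x x' -> tensor_eq y y' -> tensor_eq (TensD x y) (TensD x' y')
| tensor_eqZ a x x' : tensor_eq x x' -> tensor_eq (TensZ a x) (TensZ a x')
| tensor_eqDA x y z : tensor_eq (TensD x (TensD y z)) (TensD (TensD x y) z)
| tensor_eqDC x y : tensor_eq (TensD x y) (TensD y x)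
| tensor_eqD0 x : tensor_eq (TensD Tens0 x) x
| tensor_eqZ0 x : tensor_eq (TensZ 0 x) Tens0
| tensor_eqZ1 x : tensor_eq (TensZ 1 x) x
| tensor_eqZA a b x : tensor_eq (TensZ a (TensZ b x)) (TensZ (a * b) x)
| tensor_eqZDr a x y :
    tensor_eq (TensZ a (TensD x y)) (TensD (TensZ a x) (TensZ a y))
| tensor_eqZDl a b x :
    tensor_eq (TensZ (a + b) x) (TensD (TensZ a x) (TensZ b x))
| tensor_eqPl a u u' w :
    tensor_eq (TensP (a *: u + u') w) (TensD (TensZ a (TensP u w)) (TensP u' w))
| tensor_eqPr a u w w' :
    tensor_eq (TensP u (a *: w + w')) (TensD (TensZ a (TensP u w)) (TensP u w')).

Definition tensor_eqb : rel {classic tensor_expr} :=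
  fun x y => `[< tensor_eq x y >].

Fact tensor_eqb_refl : reflexive tensor_eqb.
Proof. by move=> x; apply/asboolP; exact: tensor_eq_refl. Qed.
Fact tensor_eqb_sym : symmetric tensor_eqb.
Proof. by move=> x y; apply/asboolP/asboolP; exact: tensor_eq_sym. Qed.
Fact tensor_eqb_trans : transitive tensor_eqb.
Proof.
move=> y x z /asboolP h /asboolP h'; apply/asboolP.
exact: tensor_eq_trans h h'.
Qed.

Canonical tensor_equiv :=
  EquivRel tensor_eqb tensor_eqb_refl tensor_eqb_sym tensor_eqb_trans.

Definition tensor : Type := {eq_quot tensor_equiv}.
HB.instance Definition _ := Choice.on tensor.

Definition tensor_class (x : tensor_expr) : tensor :=
  \pi_{eq_quot tensor_equiv} (x : {classic tensor_expr}).
Definition tensor_repr (s : tensor) : tensor_expr :=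
  repr (s : {eq_quot tensor_equiv}).

Lemma tensor_reprK s : tensor_class (tensor_repr s) = s.
Proof. exact: reprK. Qed.

Lemma tensor_class_eq x y : tensor_class x = tensor_class y <-> tensor_eq x y.
Proof.
split; first by move=> /eqmodP/asboolP.
by move=> h; apply/eqmodP/asboolP.
Qed.

Lemma tensor_repr_class x : tensor_eq (tensor_repr (tensor_class x)) x.
Proof. by apply/tensor_class_eq; rewrite tensor_reprK. Qed.

Definition tensor_add (s t : tensor) :=
  tensor_class (TensD (tensor_repr s) (tensor_repr t)).
Definition tensor_scale (a : K) (s : tensor) :=
  tensor_class (TensZ a (tensor_repr s)).

Lemma tensor_addE x y :
  tensor_add (tensor_class x) (tensor_class y) = tensor_class (TensD x y).
Proof. by apply/tensor_class_eq; apply: tensor_eqD; exact: tensor_repr_class. Qed.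

Lemma tensor_scaleE a x :
  tensor_scale a (tensor_class x) = tensor_class (TensZ a x).
Proof. by apply/tensor_class_eq; apply: tensor_eqZ; exact: tensor_repr_class. Qed.

Local Ltac tensor_lift_tac :=
  repeat (let s := fresh in move=> s; rewrite -(tensor_reprK s));
  rewrite ?(tensor_addE, tensor_scaleE); apply/tensor_class_eq.

Fact tensor_addA : associative tensor_add.
Proof. by tensor_lift_tac; constructor. Qed.
Fact tensor_addC : commutative tensor_add.
Proof. by tensor_lift_tac; constructor. Qed.
Fact tensor_add0 : left_id (tensor_class Tens0) tensor_add.
Proof. by tensor_lift_tac; constructor. Qed.
Fact tensor_addN : left_inverse (tensor_class Tens0) (tensor_scale (- 1)) tensor_add.
Proof.
move=> s; rewrite -(tensor_reprK s) tensor_scaleE tensor_addE.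
apply/tensor_class_eq; set x := tensor_repr s.
apply: (@tensor_eq_trans _ (TensD (TensZ (-1) x) (TensZ 1 x))).
  apply: tensor_eqD; first exact: tensor_eq_refl.
  by apply: tensor_eq_sym; exact: tensor_eqZ1.
apply: (@tensor_eq_trans _ (TensZ (- 1 + 1) x)).
  by apply: tensor_eq_sym; exact: tensor_eqZDl.
by rewrite addNr; exact: tensor_eqZ0.
Qed.

HB.instance Definition _ :=
  GRing.isZmodule.Build tensor tensor_addA tensor_addC tensor_add0 tensor_addN.

Fact tensor_scaleA a b (s : tensor) :
  tensor_scale a (tensor_scale b s) = tensor_scale (a * b) s.
Proof.
rewrite -(tensor_reprK s) !tensor_scaleE; apply/tensor_class_eq.
exact: tensor_eqZA.
Qed.
Fact tensor_scale1 : left_id 1 tensor_scale.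
Proof.
move=> s; rewrite -(tensor_reprK s) !tensor_scaleE; apply/tensor_class_eq.
exact: tensor_eqZ1.
Qed.
Fact tensor_scaleDr :
  right_distributive tensor_scale (+%R : tensor -> tensor -> tensor).
Proof.
move=> a s t; rewrite -(tensor_reprK s) -(tensor_reprK t).
rewrite -[_ + _ in LHS]/(tensor_add _ _) -[RHS]/(tensor_add _ _).
rewrite tensor_addE !tensor_scaleE tensor_addE.
by apply/tensor_class_eq; exact: tensor_eqZDr.
Qed.
Fact tensor_scaleDl (s : tensor) : {morph tensor_scale^~ s : a b / a + b}.
Proof.
move=> a b; rewrite -(tensor_reprK s) -[RHS]/(tensor_add _ _).
rewrite !tensor_scaleE tensor_addE.
by apply/tensor_class_eq; exact: tensor_eqZDl.
Qed.

HB.instance Definition _ := GRing.Zmodule_isLmodule.Build K tensor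
  tensor_scaleA tensor_scale1 tensor_scaleDr tensor_scaleDl.

Definition pure (u : U) (w : W) : tensor := tensor_class (TensP u w).

Lemma tensor_class0 : tensor_class Tens0 = 0.
Proof. by []. Qed.
Lemma tensor_classD x y :
  tensor_class (TensD x y) = tensor_class x + tensor_class y.
Proof. by rewrite -tensor_addE. Qed.
Lemma tensor_classZ a x : tensor_class (TensZ a x) = a *: tensor_class x.
Proof. by rewrite -tensor_scaleE. Qed.

Lemma purePl w a u u' : pure (a *: u + u') w = a *: pure u w + pure u' w.
Proof.
rewrite -tensor_classZ -tensor_classD.
by apply/tensor_class_eq; exact: tensor_eqPl.
Qed.
Lemma purePr u a w w' : pure u (a *: w + w') = a *: pure u w + pure u w'.
Proof.
rewrite -tensor_classZ -tensor_classD.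
by apply/tensor_class_eq; exact: tensor_eqPr.
Qed.

Lemma tensor_ind (P : tensor -> Prop) :
  P 0 -> (forall u w, P (pure u w)) ->
  (forall s t, P s -> P t -> P (s + t)) ->
  (forall a s, P s -> P (a *: s)) -> forall s, P s.
Proof.
move=> P0 PP PD PZ s; rewrite -(tensor_reprK s).
elim: (tensor_repr s) => [|u w|x Px y Py|a x Px].
- exact: P0.
- exact: PP.
- by rewrite tensor_classD; exact: PD.
- by rewrite tensor_classZ; exact: PZ.
Qed.

(* The linear map on the tensor product induced by a bilinear map. *)
Section Lift.
Variables (M : lmodType K) (f : U -> W -> M).

Fixpoint tensor_eval (x : tensor_expr) : M :=
  match x with
  | Tens0 => 0
  | TensP u w => f u w
  | TensD x y => tensor_eval x + tensor_eval y
  | TensZ a x => a *: tensor_eval x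
  end.

Definition tensor_lift (s : tensor) : M := tensor_eval (tensor_repr s).

Hypothesis f_linl : forall w, linear (f^~ w).
Hypothesis f_linr : forall u, linear (f u).

Lemma tensor_eval_eq x y : tensor_eq x y -> tensor_eval x = tensor_eval y.
Proof.
elim=> //=.
- by move=> ? ? ? _ -> _ ->.
- by move=> ? ? ? ? _ -> _ ->.
- by move=> ? ? ? _ ->.
- by move=> *; rewrite addrA.
- by move=> *; rewrite addrC.
- by move=> *; rewrite add0r.
- by move=> *; rewrite scale0r.
- by move=> *; rewrite scale1r.
- by move=> *; rewrite scalerA.
- by move=> *; rewrite scalerDr.
- by move=> *; rewrite scalerDl.
- by move=> a u u' w; exact: (f_linl w a u u').
- by move=> a u w w'; exact: (f_linr u a w w').
Qed.

Lemma tensor_lift_class x : tensor_lift (tensor_class x) = tensor_eval x.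
Proof. exact/tensor_eval_eq/tensor_repr_class. Qed.

Lemma tensor_lift_pure u w : tensor_lift (pure u w) = f u w.
Proof. exact: tensor_lift_class. Qed.

Lemma tensor_lift_linear : linear tensor_lift.
Proof.
move=> a s t; rewrite -(tensor_reprK s) -(tensor_reprK t).
by rewrite -tensor_classZ -tensor_classD !tensor_lift_class.
Qed.

End Lift.
End TensorProduct.

(* The product (a (x) b) (a' (x) b') = aa' (x) bb' on A (x) B. *)
Section TensorAlgebra.
Variables (K : comNzRingType) (A B : comAlgType K).

Definition tensor_mul (s t : tensor A B) : tensor A B :=
  tensor_lift (fun a b => tensor_lift (fun a' b' => pure (a * a') (b * b')) t) s.

Fact pure_mul_linl (a : A) (b b' : B) :
  linear (fun a' => pure (a * a') (b * b') : tensor A B).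
Proof. by move=> c x y; rewrite mulrDr -scalerAr purePl. Qed.
Fact pure_mul_linr (a a' : A) (b : B) :
  linear (fun b' => pure (a * a') (b * b') : tensor A B).
Proof. by move=> c x y; rewrite mulrDr -scalerAr purePr. Qed.

Let mul1 a b := tensor_lift (fun a' b' => pure (a * a') (b * b') : tensor A B).
Let mul1_linear a b : linear (mul1 a b).
Proof. by apply: tensor_lift_linear => *; [exact: pure_mul_linl|exact: pure_mul_linr]. Qed.
Let mul1_pure a b a' b' : mul1 a b (pure a' b') = pure (a * a') (b * b').
Proof. by apply: tensor_lift_pure => *; [exact: pure_mul_linl|exact: pure_mul_linr]. Qed.

Let linear_D (M N : lmodType K) (f : M -> N) : linear f -> {morph f : x y / x + y}.
Proof. by move=> lf x y; rewrite -[x]scale1r lf !scale1r. Qed.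
Let linear_0 (M N : lmodType K) (f : M -> N) : linear f -> f 0 = 0.
Proof.
move=> lf; have := linear_D lf 0 0; rewrite addr0.
by move/(congr1 (fun b => b - f 0)); rewrite addrK subrr.
Qed.
Let linear_Z (M N : lmodType K) (f : M -> N) a x : linear f -> f (a *: x) = a *: f x.
Proof. by move=> lf; rewrite -[_ *: x]addr0 lf linear_0 // addr0. Qed.

Let mul1_linl t b : linear (fun a => mul1 a b t).
Proof.
move=> c a a'; elim/tensor_ind: t => [|u w|s t IHs IHt|d s IHs].
- by rewrite !(linear_0 (mul1_linear _ _)) scaler0 addr0.
- by rewrite !mul1_pure mulrDl -scalerAl purePl.
- by rewrite !(linear_D (mul1_linear _ _)) IHs IHt scalerDr addrACA.
- by rewrite !(linear_Z _ _ (mul1_linear _ _)) IHs scalerDr !scalerA mulrC.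
Qed.
Let mul1_linr t a : linear (fun b => mul1 a b t).
Proof.
move=> c b b'; elim/tensor_ind: t => [|u w|s t IHs IHt|d s IHs].
- by rewrite !(linear_0 (mul1_linear _ _)) scaler0 addr0.
- by rewrite !mul1_pure mulrDl -scalerAl purePr.
- by rewrite !(linear_D (mul1_linear _ _)) IHs IHt scalerDr addrACA.
- by rewrite !(linear_Z _ _ (mul1_linear _ _)) IHs scalerDr !scalerA mulrC.
Qed.

Lemma tensor_mul_linl t : linear (tensor_mul^~ t).
Proof. by apply: tensor_lift_linear => *; [exact: mul1_linl|exact: mul1_linr]. Qed.
Let tensor_mul_purel a b t : tensor_mul (pure a b) t = mul1 a b t.
Proof.
apply: (@tensor_lift_pure _ _ _ _ (fun a b => mul1 a b t)) => *.
  exact: mul1_linl.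
exact: mul1_linr.
Qed.
Lemma tensor_mul_pure a b a' b' :
  tensor_mul (pure a b) (pure a' b') = pure (a * a') (b * b').
Proof. by rewrite tensor_mul_purel mul1_pure. Qed.

Lemma tensor_mul_linr s : linear (tensor_mul s).
Proof.
move=> c t t'; elim/tensor_ind: s => [|u w|s s' IHs IHs'|d s IHs].
- by rewrite !(linear_0 (tensor_mul_linl _)) scaler0 addr0.
- by rewrite !tensor_mul_purel mul1_linear.
- by rewrite !(linear_D (tensor_mul_linl _)) IHs IHs' scalerDr addrACA.
- by rewrite !(linear_Z _ _ (tensor_mul_linl _)) IHs scalerDr !scalerA mulrC.
Qed.

Let mulE :=
  (fun s => linear_0 (tensor_mul_linr s), fun t => linear_0 (tensor_mul_linl t),
   fun s => linear_D (tensor_mul_linr s), fun t => linear_D (tensor_mul_linl t),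
   fun a x s => linear_Z a x (tensor_mul_linr s),
   fun a x t => linear_Z a x (tensor_mul_linl t)).

Fact tensor_mulC : commutative tensor_mul.
Proof.
move=> s t; elim/tensor_ind: s => [|a b|s s' IH IH'|c s IH];
  rewrite ?mulE ?IH ?IH' //.
elim/tensor_ind: t => [|a' b'|s s' IH IH'|c s IH]; rewrite ?mulE ?IH ?IH' //.
by rewrite !tensor_mul_pure (mulrC a) (mulrC b).
Qed.
Fact tensor_mulA : associative tensor_mul.
Proof.
move=> s t r; elim/tensor_ind: s => [|a b|s s' IH IH'|c s IH];
  rewrite ?mulE ?IH ?IH' //.
elim/tensor_ind: t => [|a' b'|s s' IH IH'|c s IH];
  rewrite ?mulE ?IH ?IH' //.
elim/tensor_ind: r => [|a'' b''|s s' IH IH'|c s IH];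
  rewrite ?mulE ?IH ?IH' //.
by rewrite !tensor_mul_pure !mulrA.
Qed.
Fact tensor_mul1 : left_id (pure 1 1) tensor_mul.
Proof.
move=> t; elim/tensor_ind: t => [|a b|s s' IH IH'|c s IH];
  rewrite ?mulE ?IH ?IH' //.
by rewrite tensor_mul_pure !mul1r.
Qed.
Fact tensor_mulD : left_distributive tensor_mul +%R.
Proof. by move=> s s' t; rewrite mulE. Qed.

HB.instance Definition _ := GRing.Zmodule_isComPzRing.Build (tensor A B)
  tensor_mulA tensor_mulC tensor_mul1 tensor_mulD.

Definition tensor_alg (a : K) : tensor A B := a *: pure 1 1.

Lemma tensor_scaleAl (a : K) (s t : tensor A B) : a *: s * t = a *: (s * t).
Proof. exact: linear_Z _ _ (tensor_mul_linl t). Qed.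

Fact tensor_alg_additive : zmod_morphism tensor_alg.
Proof. by move=> a b; rewrite /tensor_alg scalerBl. Qed.
HB.instance Definition _ :=
  GRing.isZmodMorphism.Build K (tensor A B) tensor_alg tensor_alg_additive.
Fact tensor_alg_monoid : monoid_morphism tensor_alg.
Proof.
split; first exact: scale1r.
by move=> a b; rewrite /tensor_alg tensor_scaleAl mul1r scalerA.
Qed.
HB.instance Definition _ :=
  GRing.isMonoidMorphism.Build K (tensor A B) tensor_alg tensor_alg_monoid.

End TensorAlgebra.

Section Coproduct.
Variables (K : comNzRingType) (W : lmodType K).

Definition coproduct_in (w : W) : tensor (sym W) (sym W) :=
  pure (sym_in w) 1 + pure 1 (sym_in w).

Definition coproduct : sym W -> tensor (sym W) (sym W) :=
  sym_ext (@tensor_alg K (sym W) (sym W)) coproduct_in.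

Lemma coproduct_in_linear a v w :
  coproduct_in (a *: v + w) =
  tensor_alg (sym W) (sym W) a * coproduct_in v + coproduct_in w.
Proof.
rewrite /coproduct_in /tensor_alg tensor_scaleAl mul1r linearP/= purePl purePr.
by rewrite scalerDr addrACA.
Qed.

Lemma coproduct_sym_in w :
  coproduct (sym_in w) = pure (sym_in w) 1 + pure 1 (sym_in w).
Proof. exact/sym_ext_in/coproduct_in_linear. Qed.
Lemma coproductM s t : coproduct (s * t) = coproduct s * coproduct t.
Proof. exact/sym_extM/coproduct_in_linear. Qed.
Lemma coproductD s t : coproduct (s + t) = coproduct s + coproduct t.
Proof. exact/sym_extD/coproduct_in_linear. Qed.
Lemma coproductZ a s : coproduct (a *: s) = a *: coproduct s.
Proof.
rewrite /coproduct sym_extZ; last exact: coproduct_in_linear.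
by rewrite tensor_scaleAl mul1r.
Qed.
Lemma coproduct1 : coproduct 1 = 1.
Proof.
rewrite -[1 in LHS]scale1r /coproduct sym_extA ?rmorph1//.
exact: coproduct_in_linear.
Qed.

End Coproduct.

(* Inner products are antilinear in the first slot, linear in the second. *)
HB.mixin Record isPreHilbert (R : realType) V of GRing.Lmodule R[i] V := {
  ip : V -> V -> R[i];
  ip_linear : forall (c : R[i]) (x y z : V),
    ip x (c *: y + z) = c * ip x y + ip x z;
  ip_conj : forall x y : V, ip y x = (ip x y)^*;
  ip_ge0 : forall x : V, 0 <= ip x x;
  ip_eq0 : forall x : V, ip x x = 0 -> x = 0 }.

#[short(type="preHilbertType")]
HB.structure Definition PreHilbert (R : realType) :=
  {V of isPreHilbert R V & GRing.Lmodule R[i] V}.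

HB.mixin Record isHilbert (R : realType) V
    of PreHilbert R V & CompleteNormedModule R[i] V := {
  sqr_norm_ip : forall x : V, `|x| ^+ 2 = ip x x }.

#[short(type="hilbertType")]
HB.structure Definition Hilbert (R : realType) :=
  {V of isHilbert R V & PreHilbert R V & CompleteNormedModule R[i] V}.

Local Notation "<< x | y >>" := (ip x y)
  (at level 0, x at level 69, y at level 69, format "<< x | y >>") : ring_scope.

Section InnerProductTheory.
Variables (R : realType) (W : preHilbertType R).
Implicit Types x y z : W.

Lemma ipD x y z : <<x | y + z>> = <<x | y>> + <<x | z>>.
Proof. by rewrite -[y]scale1r ip_linear mul1r scale1r. Qed.
Lemma ip0 x : <<x | 0>> = 0.
Proof.
have := ipD x 0 0; rewrite addr0.
by move/(congr1 (fun b => b - <<x | 0>>)); rewrite addrK subrr.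
Qed.
Lemma ipZ c x y : <<x | c *: y>> = c * <<x | y>>.
Proof. by rewrite -[c *: y]addr0 ip_linear ip0 addr0. Qed.
Lemma ipDl x y z : <<x + y | z>> = <<x | z>> + <<y | z>>.
Proof. by rewrite ip_conj ipD rmorphD /= -!ip_conj. Qed.
Lemma ip0l x : <<0 | x>> = 0.
Proof. by rewrite ip_conj ip0 rmorph0. Qed.
Lemma ipZl c x y : <<c *: x | y>> = c^* * <<x | y>>.
Proof. by rewrite ip_conj ipZ rmorphM /= -ip_conj. Qed.

End InnerProductTheory.

Section Antilinear.
Variables (R : realType).

Definition antilinear (M N : lmodType R[i]) (f : M -> N) : Prop :=
  forall (c : R[i]) x y, f (c *: x + y) = c^* *: f x + f y.

Lemma antilinearD (M N : lmodType R[i]) (f : M -> N) :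
  antilinear f -> {morph f : x y / x + y}.
Proof. by move=> hf x y; rewrite -[x]scale1r hf rmorph1 !scale1r. Qed.
Lemma antilinear0 (M N : lmodType R[i]) (f : M -> N) : antilinear f -> f 0 = 0.
Proof.
move=> hf; have := antilinearD hf 0 0; rewrite addr0.
by move/(congr1 (fun b => b - f 0)); rewrite addrK subrr.
Qed.
Lemma antilinearZ (M N : lmodType R[i]) (f : M -> N) c x :
  antilinear f -> f (c *: x) = c^* *: f x.
Proof. by move=> hf; rewrite -[c *: x]addr0 hf antilinear0 // addr0. Qed.

Definition ip_symmetric (W : preHilbertType R) (Z : W -> W) : Prop :=
  forall x y : W, <<y | Z x>> = <<x | Z y>>.

End Antilinear.

Section Antidual.
Variables (R : realType) (W : lmodType R[i]).
Implicit Types (Phi Psi : sym W -> R[i]).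

(* SW', a subset of the space of all functions SW -> C *)
Definition antidual : set (sym W -> R[i]) :=
  [set Phi | antilinear (Phi : sym W -> R[i]^o)].

Lemma antidual_conj Phi c s t : antidual Phi ->
  (Phi (c *: s + t))^* = c * (Phi s)^* + (Phi t)^*.
Proof.
move=> hPhi; rewrite (hPhi c s t) -[_ *: _]/(c^* * _).
by rewrite (rmorphD (@conjc R)) (rmorphM (@conjc R)) /= conjcK.
Qed.

(* Phi (x) Psi, the antilinear functional s (x) t |-> Phi s * Psi t; its
   conjugate is linear, hence obtained from the universal property. *)
Definition antidual_tensor Phi Psi (t : tensor (sym W) (sym W)) : R[i] :=
  (tensor_lift (fun a b => (Phi a)^* * (Psi b)^* : R[i]^o) t)^*.

Lemma antidual_tensor_pure Phi Psi a b : antidual Phi -> antidual Psi ->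
  antidual_tensor Phi Psi (pure a b) = Phi a * Psi b.
Proof.
move=> hPhi hPsi; rewrite /antidual_tensor tensor_lift_pure.
- by rewrite rmorphM /= !conjcK.
- by move=> w c x y /=; rewrite (antidual_conj _ _ _ hPhi) mulrDl -mulrA.
- by move=> u c x y /=; rewrite (antidual_conj _ _ _ hPsi) mulrDr mulrCA.
Qed.

Lemma antidual_tensor_antilinear Phi Psi : antidual Phi -> antidual Psi ->
  antilinear (antidual_tensor Phi Psi : _ -> R[i]^o).
Proof.
move=> hPhi hPsi c s t; rewrite /antidual_tensor tensor_lift_linear.
- by rewrite (rmorphD (@conjc R)) (rmorphM (@conjc R)).
- by move=> w d x y /=; rewrite (antidual_conj _ _ _ hPhi) mulrDl -mulrA.
- by move=> u d x y /=; rewrite (antidual_conj _ _ _ hPsi) mulrDr mulrCA.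
Qed.

Definition antidual_mul Phi Psi (s : sym W) : R[i] :=
  antidual_tensor Phi Psi (coproduct s).

(* The unit of SW': 1 on the vector 1, and 0 on S^n W for n > 0. *)
Definition antidual_one : sym W -> R[i] := sym_ext (@conjc R) (fun=> 0).

Definition antidual_exp Phi (n : nat) : sym W -> R[i] :=
  iter n (antidual_mul Phi) antidual_one.

End Antidual.

Section Fock.
Variables (R : realType) (W : preHilbertType R).
Implicit Types (v : W) (s : sym W) (Phi : sym W -> R[i]).

Definition creator v s : sym W := sym_in v * s.
Definition bra v (w : W) : sym W := <<v | w>>%:A.
Definition annihilator v : sym W -> sym W := sym_der (bra v).

Definition pi_sym v s : sym W :=
  (Num.sqrt 2)^-1%:C *: (creator v s + annihilator v s).

Definition creator' v Phi : sym W -> R[i] := fun s => Phi (annihilator v s).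
Definition annihilator' v Phi : sym W -> R[i] := fun s => Phi (creator v s).

Definition pi_antidual v Phi : sym W -> R[i] :=
  fun s => (Num.sqrt 2)^-1%:C * (creator' v Phi s + annihilator' v Phi s).

Definition is_zeta (Z : W -> W) (zeta : sym W -> R[i]) : Prop :=
  [/\ antidual zeta,
      forall n : nat, n != 2%N -> forall s, sym_pow n s -> zeta s = 0 &
      forall x y : W, zeta (sym_in x * sym_in y) = <<y | Z x>>].

Definition zeta (Z : W -> W) : sym W -> R[i] := xget (fun=> 0) (is_zeta Z).

(* e^Z as a pointwise sum; at each s only finitely many terms are nonzero. *)
Definition gaussian (Z : W -> W) (s : sym W) : R[i] :=
  limn (series (fun n => n`!%:R^-1 * antidual_exp (zeta Z) n s : R[i]^o)).

End Fock.

(* V_C = C (x)_R V; Cplx x y stands for 1 (x) x + i (x) y. *)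
Section Complexification.
Variables (R : realType) (V : preHilbertType R).

Record cplx : Type := Cplx { cre : V; cim : V }.

Definition cplx_pair (x : cplx) : V * V := (cre x, cim x).
Definition pair_cplx (p : V * V) : cplx := Cplx p.1 p.2.
Fact cplx_pairK : cancel cplx_pair pair_cplx.
Proof. by case. Qed.
HB.instance Definition _ := Choice.copy cplx (can_type cplx_pairK).

Definition cplx_add (x y : cplx) := Cplx (cre x + cre y) (cim x + cim y).
Definition cplx_opp (x : cplx) := Cplx (- cre x) (- cim x).
Definition cplx_scale (c : R[i]) (x : cplx) :=
  Cplx ((complex.Re c)%:C *: cre x - (complex.Im c)%:C *: cim x)
       ((complex.Re c)%:C *: cim x + (complex.Im c)%:C *: cre x).

Fact cplx_addA : associative cplx_add.
Proof. by move=> [? ?] [? ?] [? ?]; rewrite /cplx_add /= !addrA. Qed.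
Fact cplx_addC : commutative cplx_add.
Proof.
by move=> [a b] [c d]; rewrite /cplx_add /= (addrC a) (addrC b).
Qed.
Fact cplx_add0 : left_id (Cplx 0 0) cplx_add.
Proof. by move=> [? ?]; rewrite /cplx_add /= !add0r. Qed.
Fact cplx_addN : left_inverse (Cplx 0 0) cplx_opp cplx_add.
Proof. by move=> [? ?]; rewrite /cplx_add /= !addNr. Qed.
HB.instance Definition _ :=
  GRing.isZmodule.Build cplx cplx_addA cplx_addC cplx_add0 cplx_addN.

Fact cplx_scaleA a b (x : cplx) :
  cplx_scale a (cplx_scale b x) = cplx_scale (a * b) x.
Proof.
case: a b x => [a a'] [b b'] [x y]; rewrite /cplx_scale /=; congr Cplx.
- rewrite !scalerDr !scalerN !scalerA -!rmorphM /= rmorphB rmorphD /=.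
  rewrite scalerBl scalerDl !opprD.
  by rewrite [- ((a' * b)%:C *: y) - _]addrC addrACA.
- rewrite !scalerDr !scalerN !scalerA -!rmorphM /= rmorphB rmorphD /=.
  by rewrite scalerBl scalerDl [_ *: x - _]addrC addrACA.
Qed.
Fact cplx_scale1 : left_id 1 cplx_scale.
Proof.
move=> [x y]; rewrite /cplx_scale /= rmorph0 rmorph1 !scale0r !scale1r.
by rewrite subr0 addr0.
Qed.
Fact cplx_scaleDr : right_distributive cplx_scale cplx_add.
Proof.
move=> c [x y] [x' y']; rewrite /cplx_scale /cplx_add /=; congr Cplx.
  by rewrite !scalerDr opprD addrACA.
by rewrite !scalerDr addrACA.
Qed.
Fact cplx_scaleDl (x : cplx) : {morph cplx_scale^~ x : a b / a + b}.
Proof.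
case: x => x y [a a'] [b b']; rewrite /cplx_scale /= !rmorphD /=; congr Cplx.
  by rewrite !scalerDl opprD addrACA.
by rewrite !scalerDl addrACA.
Qed.
HB.instance Definition _ := GRing.Zmodule_isLmodule.Build R[i] cplx
  cplx_scaleA cplx_scale1 cplx_scaleDr cplx_scaleDl.

Definition J (v : V) : V := 'i%C *: v.
Definition Omega (v w : V) : R := complex.Im <<v | w>>.

Definition cplx_in (v : V) : cplx := Cplx v 0.
Definition cplx_conj (x : cplx) : cplx := Cplx (cre x) (- cim x).

(* The complex-(bi)linear extensions of J and Omega. *)
Definition J_C (x : cplx) : cplx := Cplx (J (cre x)) (J (cim x)).
Definition Omega_C (x y : cplx) : R[i] :=
  (Omega (cre x) (cre y) - Omega (cim x) (cim y))
  +i* (Omega (cre x) (cim y) + Omega (cim x) (cre y)).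

Definition cplx_ip (x y : cplx) : R[i] := Omega_C (cplx_conj x) (J_C y).

End Complexification.

Section ComplexificationInnerProduct.
Variables (R : realType) (V : preHilbertType R).
Implicit Types (x y z : cplx V) (a b c : V).

Let rip a b : R := complex.Re <<a | b>>.

Let ripD a b c : rip a (b + c) = rip a b + rip a c.
Proof. by rewrite /rip ipD; case: <<a | b>> <<a | c>> => [? ?] [? ?]. Qed.
Let ripZ (r : R) a b : rip a (r%:C *: b) = r * rip a b.
Proof. by rewrite /rip ipZ; case: <<a | b>> => [? ?] /=; rewrite mul0r subr0. Qed.
Let ripN a b : rip a (- b) = - rip a b.
Proof. by rewrite -scaleN1r -(rmorphN1 (real_complex R)) ripZ mulN1r. Qed.
Let ripC a b : rip a b = rip b a.
Proof. by rewrite /rip ip_conj; case: <<b | a>>. Qed.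
Let OmegaJ a b : Omega a (J b) = rip a b.
Proof.
rewrite /Omega /J ipZ /rip; case: <<a | b>> => [? ?] /=.
by rewrite mul0r mul1r add0r.
Qed.
Let cplx_ipE x y : cplx_ip x y =
  (rip (cre x) (cre y) + rip (cim x) (cim y))
  +i* (rip (cre x) (cim y) - rip (cim x) (cre y)).
Proof.
rewrite /cplx_ip /Omega_C /= !OmegaJ.
by rewrite ![rip (- _) _]ripC !ripN opprK (ripC (cim y)) (ripC (cre y)).
Qed.

Fact cplx_ip_linear (c : R[i]) x y z :
  cplx_ip x (c *: y + z) = c * cplx_ip x y + cplx_ip x z.
Proof.
case: c => s t; rewrite !cplx_ipE /= !ripD !ripN !ripZ; congr (_ +i* _); ring.
Qed.
Fact cplx_ip_conj x y : cplx_ip y x = (cplx_ip x y)^*.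
Proof.
rewrite !cplx_ipE /= opprB (ripC (cre y)) (ripC (cim y)) (ripC (cre y) (cim x)).
by rewrite (ripC (cim y)).
Qed.

Let cplx_ipxx x :
  cplx_ip x x = (rip (cre x) (cre x) + rip (cim x) (cim x))%:C.
Proof. by rewrite cplx_ipE (ripC (cim x) (cre x)) subrr. Qed.
Let ip_rip a : <<a | a>> = (rip a a)%:C.
Proof.
have := ip_ge0 a; rewrite /rip; case: <<a | a>> => r s.
by rewrite lecE /= => /andP[/eqP -> _].
Qed.
Let rip_ge0 a : 0 <= rip a a.
Proof. by rewrite -lecR -ip_rip ip_ge0. Qed.

Fact cplx_ip_ge0 x : 0 <= cplx_ip x x.
Proof. by rewrite cplx_ipxx lecR addr_ge0 ?rip_ge0. Qed.
Fact cplx_ip_eq0 x : cplx_ip x x = 0 -> x = 0.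
Proof.
rewrite cplx_ipxx => -[/eqP]; rewrite paddr_eq0 ?rip_ge0// => /andP[/eqP h /eqP h'].
have {}h : cre x = 0 by apply: ip_eq0; rewrite ip_rip h.
have {}h' : cim x = 0 by apply: ip_eq0; rewrite ip_rip h'.
by case: x h h' => /= ? ? -> ->.
Qed.

HB.instance Definition _ := isPreHilbert.Build R (cplx V)
  cplx_ip_linear cplx_ip_conj cplx_ip_ge0 cplx_ip_eq0.

Definition vplus (v : V) : cplx V :=
  (Num.sqrt 2)^-1%:C *: (cplx_in v - 'i%C *: cplx_in (J v)).
Definition vminus (v : V) : cplx V :=
  (Num.sqrt 2)^-1%:C *: (cplx_in v + 'i%C *: cplx_in (J v)).

Definition sym_plus : sym V -> sym (cplx V) :=
  sym_ext (fun c : R[i] => c%:A) (fun v => sym_in (vplus v)).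
Definition sym_minus : sym V -> sym (cplx V) :=
  sym_ext (fun c : R[i] => c^*%:A) (fun v => sym_in (vminus v)).

End ComplexificationInnerProduct.

Section Symplectic.
Variables (R : realType) (V : hilbertType R).
Implicit Types (g f : V -> V) (v : V).

Definition Sp : set (V -> V) :=
  [set g | [/\ forall (r : R) x y, g (r%:C *: x + y) = r%:C *: g x + g y,
               bijective g &
               forall x y, Omega (g x) (g y) = Omega x y]].

(* The inverse when f is bijective, an arbitrary function otherwise. *)
Definition inverse f : V -> V := fun y => xget 0 [set x | f x = y].

Lemma inverseK f : bijective f -> cancel f (inverse f) /\ cancel (inverse f) f.
Proof.
move=> [h fK hK]; have ihK : cancel (inverse f) f.
  by move=> y; rewrite /inverse; case: xgetP => [x _ //|/(_ (h y))/=]; rewrite hK.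
by split=> // x; apply: (can_inj fK); rewrite ihK.
Qed.

Definition C_ g v : V := 2%:R^-1 *: (g v - J (g (J v))).
Definition A_ g v : V := 2%:R^-1 *: (g v + J (g (J v))).
Definition Z_ g v : V := inverse (C_ g) (A_ g v).

Definition weak_metaplectic g (U : sym V -> sym V -> R[i]) : Prop :=
  [/\ forall phi, antidual (U phi),
      forall (c : R[i]) phi phi' psi,
        U (c *: phi + phi') psi = c * U phi psi + U phi' psi,
      exists phi psi, U phi psi != 0 &
      forall v phi, U (pi_sym v phi) = pi_antidual (g v) (U phi)].

Definition kernel_map g (Z : cplx V -> cplx V) : Prop :=
  antilinear Z /\
  forall v,
    Z (vplus v) = vminus (inverse (C_ g) v) + vplus (Z_ (inverse g) v) /\
    Z (vminus v) =
      vplus (inverse (C_ (inverse g)) v) + vminus (Z_ g v).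

Definition kernel_operator (u : sym (cplx V) -> R[i]) :
    sym V -> sym V -> R[i] :=
  fun phi psi => u (sym_plus psi * sym_minus phi).

End Symplectic.

Section SymSpan.
Variables (K : comNzRingType) (W : lmodType K).

Lemma sym_span (s : sym W) : exists l : seq (K * seq W),
  s = \sum_(p <- l) p.1 *: \prod_(w <- p.2) sym_in w.
Proof.
elim/sym_ind: s => [a|w|s t [l ->] [m ->]|s t [l ->] [m ->]].
- by exists [:: (a, [::])]; rewrite big_seq1 big_nil.
- by exists [:: (1, [:: w])]; rewrite big_seq1 big_seq1 scale1r.
- by exists (l ++ m); rewrite big_cat.
- exists [seq (p.1 * q.1, p.2 ++ q.2) | p <- l, q <- m].
  rewrite big_allpairs_dep mulr_suml; apply: eq_bigr => p _.
  rewrite mulr_sumr; apply: eq_bigr => q _ /=.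
  by rewrite big_cat/= -scalerAl -scalerAr scalerA.
Qed.

Lemma sym_pow_prod (ws : seq W) :
  sym_pow (size ws) (\prod_(w <- ws) sym_in w).
Proof.
exists 1%N, (fun=> 1), (fun=> in_tuple ws).
by rewrite big_ord1 scale1r.
Qed.

End SymSpan.

Section FockTheory.
Variables (R : realType) (W : preHilbertType R).
Implicit Types (v w : W) (s t : sym W).

Fact bra_linear v : linear (bra v).
Proof. by move=> c x y; rewrite /bra ip_linear scalerDl scalerA. Qed.
HB.instance Definition _ v :=
  GRing.isLinear.Build R[i] W (sym W) *:%R (bra v) (bra_linear v).

Lemma annihilator1 v : annihilator v 1 = 0.
Proof. exact: (sym_der1 (bra v)). Qed.
Lemma annihilator_in v w : annihilator v (sym_in w) = <<v | w>>%:A.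
Proof. exact: (sym_der_in (bra v)). Qed.
Lemma annihilatorM v s t :
  annihilator v (s * t) = annihilator v s * t + s * annihilator v t.
Proof. exact: (sym_derM (bra v)). Qed.
Lemma annihilator_linear v : linear (annihilator v).
Proof.
move=> c s t; rewrite /annihilator.
by rewrite (sym_derD (bra v)) (sym_derZ (bra v)).
Qed.

Lemma antidual_sum (Phi : sym W -> R[i]) (I : Type) (r : seq I)
    (a : I -> R[i]) (F : I -> sym W) : antidual Phi ->
  Phi (\sum_(i <- r) a i *: F i) = \sum_(i <- r) (a i)^* * Phi (F i).
Proof.
move=> hPhi; elim: r => [|i r IH]; first by rewrite !big_nil (antilinear0 hPhi).
by rewrite !big_cons (hPhi (a i)) IH.
Qed.

Lemma is_zeta_uniq (Z : W -> W) z z' : is_zeta Z z -> is_zeta Z z' -> z = z'.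
Proof.
move=> [za z0 z2] [za' z0' z2']; apply/funext => s.
have [r ->] := sym_span s; rewrite !antidual_sum//.
apply: eq_bigr => -[c ws] _ /=; congr (_ * _).
have [|ne2] := eqVneq (size ws) 2%N; last first.
  by rewrite (z0 _ ne2) ?(z0' _ ne2)//; exact: sym_pow_prod.
case: ws => [|x [|y []]]//= _.
by rewrite !big_cons !big_nil !mulr1 z2 z2'.
Qed.

Section Existence.
Variables (Z : W -> W).
Hypotheses (Za : antilinear Z) (Zs : ip_symmetric Z).

Let q v w : R[i] := <<w | Z v>>^*.
Let qC v w : q v w = q w v.
Proof. by rewrite /q Zs. Qed.
Let qP u c v w : q u (c *: v + w) = c * q u v + q u w.
Proof.
rewrite /q ipDl ipZl (rmorphD (@conjc R)) (rmorphM (@conjc R)) /=.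
by rewrite conjcK.
Qed.
Let q0 v : q v 0 = 0.
Proof. by rewrite /q ip0l (rmorph0 (@conjc R)). Qed.
Let qD u v w : q u (v + w) = q u v + q u w.
Proof. by rewrite -[v]scale1r qP mul1r scale1r. Qed.
Let qZ u c v : q u (c *: v) = c * q u v.
Proof. by rewrite -[c *: v]addr0 qP q0 addr0. Qed.

Let qDl u v w : q (u + v) w = q u w + q v w.
Proof. by rewrite qC qD !(qC w). Qed.
Let qZl c u w : q (c *: u) w = c * q u w.
Proof. by rewrite qC qZ (qC w). Qed.

(* The components of degree 0 and 1 of an element of sym W, and the value at
   its component of degree 2 of the conjugate of the functional sought. *)
Let Fixpoint d (x : sym_expr W) : R[i] * W * R[i] :=
  match x with
  | SymC a => (a, 0, 0)
  | SymG w => (0, w, 0)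
  | SymD x y => d x + d y
  | SymM x y =>
      ((d x).1.1 * (d y).1.1,
       (d x).1.1 *: (d y).1.2 + (d y).1.1 *: (d x).1.2,
       (d x).1.1 * (d y).2 + (d y).1.1 * (d x).2 + q (d x).1.2 (d y).1.2)
  end.

Let addE3 (a b : R[i]) (v w : W) (p r : R[i]) :
  (a, v, p) + (b, w, r) = (a + b, v + w, p + r).
Proof. by []. Qed.

Let d_eq x y : sym_eq x y -> d x = d y.
Proof.
elim=> //=.
- by move=> ? ? ? _ -> _ ->.
- by move=> ? ? ? ? _ -> _ ->.
- by move=> ? ? ? ? _ -> _ ->.
- by move=> *; rewrite addrA.
- by move=> *; rewrite addrC.
- by move=> x0; rewrite add0r.
- move=> x0 y0 z; case: (d x0) (d y0) (d z) => [[a u] p] [[b v] r] [[c w] t] /=.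
  congr (_, _, _); first by rewrite mulrA.
    rewrite !scalerDr !scalerA addrA (mulrC b c) (mulrC c a).
    by rewrite -!addrA (mulrC c b).
  by rewrite qD qDl !qZ !qZl; ring.
- move=> x0 y0; case: (d x0) (d y0) => [[a u] p] [[b v] r] /=.
  by rewrite mulrC addrC (qC v) (addrC (a * r)).
- move=> x0; case: (d x0) => [[a u] p] /=.
  by rewrite qC q0 !mul1r scale1r scaler0 mulr0 !addr0.
- move=> x0; case: (d x0) => [[a u] p] /=.
  by rewrite qC q0 !mul0r scale0r scaler0 mulr0 !addr0.
- move=> x0 y0 z; case: (d x0) (d y0) (d z) => [[a u] p] [[b v] r] [[c w] t] /=.
  rewrite addE3; congr (_, _, _); first by rewrite mulrDl.
    by rewrite scalerDl scalerDr addrACA.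
  by rewrite qDl; ring.
- by move=> a b; rewrite addE3 !addr0.
- by move=> a b; rewrite !scaler0 q0 !mulr0 !addr0.
- by move=> v w; rewrite addE3 !addr0.
- by move=> a w; rewrite qC q0 !mulr0 scale0r !addr0.
Qed.

Let D s := d (sym_repr s).
Let D_class x : D (sym_class x) = d x.
Proof. exact/d_eq/sym_repr_class. Qed.
Let DA a : D a%:A = (a, 0, 0).
Proof. by rewrite -sym_classC D_class. Qed.
Let Din w : D (sym_in w) = (0, w, 0).
Proof. exact: D_class. Qed.
Let DD s t : D (s + t) = D s + D t.
Proof. by rewrite -(sym_reprK s) -(sym_reprK t) -sym_classD !D_class. Qed.
Let DM s t : D (s * t) =
  ((D s).1.1 * (D t).1.1, (D s).1.1 *: (D t).1.2 + (D t).1.1 *: (D s).1.2,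
   (D s).1.1 * (D t).2 + (D t).1.1 * (D s).2 + q (D s).1.2 (D t).1.2).
Proof. by rewrite -(sym_reprK s) -(sym_reprK t) -sym_classM !D_class. Qed.
Let DZ a s : (D (a *: s)).2 = a * (D s).2.
Proof. by rewrite -mulr_algl DM DA /= qC q0 mulr0 !addr0. Qed.

Lemma is_zeta_exists : exists z, is_zeta Z z.
Proof.
have ha : antidual (fun s => (D s).2^*).
  move=> c s t /=; rewrite DD /= DZ.
  by rewrite (rmorphD (@conjc R)) (rmorphM (@conjc R)).
exists (fun s => (D s).2^*); split=> // [n n2 s [k [a [ws ->]]]|x y].
  rewrite (antidual_sum _ _ _ ha) big1// => i _.
  have : size (ws i) != 2%N by rewrite size_tuple.
  have D3 x y z (us : seq W) :
      D (\prod_(w <- [:: x, y, z & us]) sym_in w) = (0, 0, 0).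
    elim: us x y z => [|u us IH] x y z.
      rewrite !big_cons big_nil mulr1 !DM !Din /= !mul0r !scale0r !addr0.
      by rewrite !q0 ?mul0r !addr0.
    by rewrite big_cons DM IH Din /= !mul0r !scale0r !q0 !addr0.
  move=> ws2; suff -> : (D (\prod_(w <- ws i) sym_in w)).2 = 0.
    by rewrite (rmorph0 (@conjc R)) mulr0.
  move: ws2; case: (tval (ws i)) => [|x [|y [|z us]]]// _.
  - by rewrite big_nil -(scale1r 1) DA.
  - by rewrite big_seq1 Din.
  - by rewrite D3.
by rewrite DM !Din /= !mul0r !add0r /q conjcK.
Qed.

Lemma zetaP : is_zeta Z (zeta Z).
Proof.
have [z hz] := is_zeta_exists; rewrite /zeta.
by case: xgetP => // /(_ z).
Qed.

End Existence.
End FockTheory.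

Section PlusMinusTheory.
Variables (R : realType) (V : preHilbertType R).
Implicit Types (v : V) (s t : sym V).

Let r : R[i] := (Num.sqrt 2)^-1%:C.

Let cplxZ (c : R) (x y : V) : c%:C *: Cplx x y = Cplx (c%:C *: x) (c%:C *: y).
Proof. by congr Cplx; rewrite /= rmorph0 scale0r ?subr0 ?addr0. Qed.
Let cplxI (x y : V) : 'i%C *: Cplx x y = Cplx (- y) x.
Proof.
by congr Cplx; rewrite /= rmorph0 rmorph1 scale0r scale1r add0r.
Qed.
Let cplxE (c : R[i]) (x y : V) : c *: Cplx x y =
  Cplx ((complex.Re c)%:C *: x - (complex.Im c)%:C *: y)
       ((complex.Re c)%:C *: y + (complex.Im c)%:C *: x).
Proof. by []. Qed.
Let cplxD (x y x' y' : V) : Cplx x y + Cplx x' y' = Cplx (x + x') (y + y').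
Proof. by []. Qed.

Let cplxN (x y : V) : - Cplx x y = Cplx (- x) (- y).
Proof. by []. Qed.

Lemma vplusE v : vplus v = Cplx (r *: v) (- (r *: J v)).
Proof.
by rewrite /vplus /cplx_in cplxI cplxN cplxD !oppr0 addr0 add0r cplxZ scalerN.
Qed.
Lemma vminusE v : vminus v = Cplx (r *: v) (r *: J v).
Proof.
by rewrite /vminus /cplx_in cplxI oppr0 cplxD addr0 add0r cplxZ.
Qed.

Let ReIm (c : R[i]) (v : V) :
  c *: v = (complex.Re c)%:C *: v + (complex.Im c)%:C *: J v.
Proof.
rewrite /J scalerA -scalerDl; congr (_ *: _).
by case: c => a b /=; congr (_ +i* _); ring.
Qed.
Let JJ v : J (J v) = - v.
Proof. by rewrite /J scalerA -expr2 sqr_i scaleN1r. Qed.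
Let JD v w : J (v + w) = J v + J w.
Proof. exact: scalerDr. Qed.
Let JZ c v : J (c *: v) = c *: J v.
Proof. by rewrite /J !scalerA mulrC. Qed.

Lemma vplus_linear : linear (@vplus R V).
Proof.
move=> c v w; rewrite !vplusE cplxE cplxD !JD !JZ (ReIm c v) (ReIm c (J v)) JJ.
rewrite !scalerDr !scalerN !scalerA !opprD !opprK !(mulrC r).
by congr Cplx.
Qed.
Lemma vminus_antilinear : antilinear (@vminus R V).
Proof.
move=> c v w; rewrite !vminusE cplxE cplxD !JD !JZ (ReIm c v) (ReIm c (J v)) JJ.
rewrite !scalerDr !scalerN !scalerA !(mulrC r).
case: c => a b /=; rewrite !rmorphN !mulNr !scaleNr opprK.
by congr Cplx.
Qed.

Let plusP c x y : sym_in (vplus (c *: x + y)) =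
  in_alg (sym (cplx V)) c * sym_in (vplus x) + sym_in (vplus y).
Proof. by rewrite vplus_linear linearP mulr_algl. Qed.

Lemma sym_plus_in v : sym_plus (sym_in v) = sym_in (vplus v).
Proof. exact: (sym_ext_in plusP). Qed.
Lemma sym_plusM s t : sym_plus (s * t) = sym_plus s * sym_plus t.
Proof. exact: (sym_extM plusP). Qed.
Lemma sym_plus_linear : linear (@sym_plus R V).
Proof.
move=> c s t; rewrite /sym_plus (sym_extD plusP) (sym_extZ plusP).
by rewrite mulr_algl.
Qed.

Let minusP c x y : sym_in (vminus (c *: x + y)) =
  (in_alg (sym (cplx V)) \o @conjc R) c * sym_in (vminus x) + sym_in (vminus y).
Proof. by rewrite vminus_antilinear linearP mulr_algl. Qed.

Lemma sym_minus_in v : sym_minus (sym_in v) = sym_in (vminus v).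
Proof. exact: (sym_ext_in minusP). Qed.
Lemma sym_minusM s t : sym_minus (s * t) = sym_minus s * sym_minus t.
Proof. exact: (sym_extM minusP). Qed.
Lemma sym_minus_antilinear : antilinear (@sym_minus R V).
Proof.
move=> c s t; rewrite /sym_minus (sym_extD minusP) (sym_extZ minusP).
by rewrite mulr_algl.
Qed.

End PlusMinusTheory.

(* Main.v *)
Require Import Defs.
From mathcomp Require Import all_boot all_order all_algebra reals.
From mathcomp Require Import ring lra complex boolp classical_sets topology.
From mathcomp Require Import normedtype sequences.

(**
Contraction with a generator [w] is a derivation of [SW'] that maps [zeta Z] to
[<. | Z w>], so [e^Z (w s) = e^Z (a(Z w) s)]. On products [psi_+ phi_-] the
annihilators of [V_+] and [V_-] act on [psi] and on [phi] separately, so the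
formulas for [Z] turn this identity, with [h] the inverse of [g], into
  [U phi (v psi) = U (a(C_g^-1 v) phi) psi + U phi (a(Z_h v) psi)],
  [U (v phi) psi = U phi (a(C_h^-1 v) psi) + U (a(Z_g v) phi) psi].
The intertwining relation follows from [C_g^-1 g = 1 + Z_g] and
[C_h^-1 = (1 + Z_h) g].

Since [<C_g x | y> = <x | C_h y>] and [|C_g x|^2 = |x|^2 + |A_g x|^2], the map
[C_g] is bounded below and its adjoint [C_h] is injective; completeness of [V]
then makes [C_g] bijective, without any use of the continuity of [g].
*)

Set Implicit Arguments.
Unset Strict Implicit.
Unset Printing Implicit Defensive.

Import Order.TTheory GRing.Theory Num.Theory.
Import numFieldNormedType.Exports.

Local Open Scope ring_scope.
Local Open Scope complex_scope.
Local Open Scope classical_set_scope.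

Local Notation "z ^*" := (conjc z) : ring_scope.
Local Notation "<< x | y >>" := (ip x y)
  (at level 0, x at level 69, y at level 69, format "<< x | y >>") : ring_scope.

(** * Gaussians on the symmetric algebra *)

(** Words in the generators span by [sym_span], and [0] is [-1 *: 1 + 1]. Identities of Leibniz type
    can then be checked one generator at a time. *)
Lemma sym_mul_ind (K : comNzRingType) (W : lmodType K) (P : sym W -> Prop) :
  P 1 -> (forall w s, P s -> P (sym_in w * s)) ->
  (forall c s t, P s -> P t -> P (c *: s + t)) -> forall s, P s.
Proof.
move=> P1 PM PP s; have P0 : P 0 by rewrite -(addNr 1) -scaleN1r; exact: PP.
have [l ->] := sym_span s; elim: l => [|[c ws] l IH]; first by rewrite big_nil.
rewrite big_cons; apply: PP => //=.
by elim: ws => [|w ws IHw]; rewrite ?big_nil // big_cons; exact: PM.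
Qed.

Lemma pureM (K : comNzRingType) (A B : comAlgType K) (a a' : A) (b b' : B) :
  pure a b * pure a' b' = pure (a * a') (b * b').
Proof. exact: tensor_mul_pure. Qed.

(** * The algebra of antilinear functionals *)

Section AntidualAlgebra.
Variables (R : realType) (W : lmodType R[i]).
Implicit Types (Phi Psi : sym W -> R[i]) (s t : sym W).

Lemma antidualP Phi : antidual Phi ->
  forall c s t, Phi (c *: s + t) = c^* * Phi s + Phi t.
Proof. by move=> h c s t; rewrite (h c s t). Qed.

Lemma antidualD Phi : antidual Phi -> {morph Phi : s t / s + t}.
Proof. by move=> h s t; rewrite (antilinearD h). Qed.

Lemma antidualZ Phi : antidual Phi -> forall c s, Phi (c *: s) = c^* * Phi s.
Proof. by move=> h c s; rewrite (antilinearZ _ _ h). Qed.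

Lemma antidual_mul_antidual Phi Psi : antidual Phi -> antidual Psi ->
  antidual (antidual_mul Phi Psi).
Proof.
move=> hPhi hPsi c s t; rewrite /antidual_mul coproductD coproductZ.
exact: antidual_tensor_antilinear.
Qed.

Lemma antidual_mul1 Phi Psi : antidual Phi -> antidual Psi ->
  antidual_mul Phi Psi 1 = Phi 1 * Psi 1.
Proof.
by move=> hPhi hPsi; rewrite /antidual_mul coproduct1 antidual_tensor_pure.
Qed.

Lemma antidual_mulPl Phi Phi' Psi c s : antidual Phi -> antidual Phi' ->
  antidual Psi ->
  antidual_mul (fun t => c * Phi t + Phi' t) Psi s =
  c * antidual_mul Phi Psi s + antidual_mul Phi' Psi s.
Proof.
move=> h h' hPsi.
have hP : antidual (fun t => c * Phi t + Phi' t).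
  by move=> d x y /=; rewrite (antidualP h) (antidualP h') /GRing.scale /=; ring.
rewrite /antidual_mul; elim/tensor_ind: (coproduct s) => [|a b|x y IHx IHy|d x IHx].
- by rewrite !(antilinear0 (antidual_tensor_antilinear _ _)) // mulr0 addr0.
- by rewrite !antidual_tensor_pure // mulrDl mulrA.
- rewrite !(antilinearD (antidual_tensor_antilinear _ _)) // IHx IHy; ring.
- rewrite !(antilinearZ _ _ (antidual_tensor_antilinear _ _)) // IHx /GRing.scale /=.
  ring.
Qed.

(** This is [annihilator'], written for a module without inner product. *)
Definition contraction (w : W) Phi : sym W -> R[i] := fun s => Phi (sym_in w * s).

Lemma contraction_antidual w Phi : antidual Phi -> antidual (contraction w Phi).
Proof. by move=> h c s t; rewrite /contraction mulrDr -scalerAr h. Qed.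

(* The generators are primitive for the coproduct. *)
Lemma antidual_mul_in Phi Psi w s : antidual Phi -> antidual Psi ->
  antidual_mul Phi Psi (sym_in w * s) =
  antidual_mul (contraction w Phi) Psi s + antidual_mul Phi (contraction w Psi) s.
Proof.
move=> h h'; have hc := contraction_antidual w h.
have hc' := contraction_antidual w h'.
rewrite /antidual_mul coproductM coproduct_sym_in.
elim/tensor_ind: (coproduct s) => [|a b|x y IHx IHy|d x IHx].
- by rewrite mulr0 !(antilinear0 (antidual_tensor_antilinear _ _)) // addr0.
- rewrite mulrDl (antilinearD (antidual_tensor_antilinear h h')).
  by rewrite !pureM !mul1r !antidual_tensor_pure.
- rewrite mulrDr !(antilinearD (antidual_tensor_antilinear _ _)) // IHx IHy; ring.
- rewrite mulrC tensor_scaleAl mulrC.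
  by rewrite !(antilinearZ _ _ (antidual_tensor_antilinear _ _)) // IHx scalerDr.
Qed.

Lemma antidual_mul_ext Phi Phi' Psi :
  Phi =1 Phi' -> antidual_mul Phi Psi =1 antidual_mul Phi' Psi.
Proof. by move=> /funext ->. Qed.

(** Peeling a generator off the argument leaves two Leibniz terms, which the exchange of factors
    permutes. The induction generalizes [Phi] and [Psi], since contraction changes them. *)
Lemma antidual_mulC Phi Psi : antidual Phi -> antidual Psi ->
  antidual_mul Phi Psi =1 antidual_mul Psi Phi.
Proof.
move=> h h' s; elim/sym_mul_ind: s Phi Psi h h' => [|w s IH|c s t IHs IHt] Phi Psi h h'.
- by rewrite !antidual_mul1 // mulrC.
- rewrite !antidual_mul_in // addrC IH //; last exact: contraction_antidual.
  by rewrite [X in _ + X]IH //; exact: contraction_antidual.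
- rewrite (antidualP (antidual_mul_antidual h h')) IHs // IHt //.
  by rewrite (antidualP (antidual_mul_antidual h' h)).
Qed.

Let oneP (c : R[i]) (x y : W) :
  (fun=> 0 : R[i]) (c *: x + y) = conjc c * 0 + 0.
Proof. by rewrite mulr0 addr0. Qed.

Lemma antidual_one_antidual : antidual (@antidual_one R W).
Proof.
move=> c s t; rewrite /antidual_one.
by rewrite (sym_extD (phi := @conjc R) oneP) (sym_extZ (phi := @conjc R) oneP).
Qed.

Lemma antidual_one1 : antidual_one (1 : sym W) = 1.
Proof.
by rewrite -[X in antidual_one X]scale1r /antidual_one
  (sym_extA (phi := @conjc R) oneP) rmorph1.
Qed.

Lemma antidual_one_in w s : antidual_one (sym_in w * s) = 0.
Proof.
rewrite /antidual_one (sym_extM (phi := @conjc R) oneP).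
by rewrite (sym_ext_in (phi := @conjc R) oneP) mul0r.
Qed.

Lemma antidual_zero : antidual (fun _ : sym W => 0 : R[i]).
Proof. by move=> c x y; rewrite scaler0 addr0. Qed.

Lemma antidual_mul0l Psi : antidual Psi -> antidual_mul (fun=> 0) Psi =1 fun=> 0.
Proof.
have h0 := antidual_zero; move=> hPsi s.
(* The zero functional is written as [-1 * 0 + 0], so its product has the form [- x + x]. *)
have := antidual_mulPl (-1) s h0 h0 hPsi; rewrite [X in _ = X + _]mulN1r addNr.
by apply: etrans; apply: antidual_mul_ext => t; rewrite mulN1r addNr.
Qed.

(** Contraction kills the unit, so only the Leibniz term that contracts [Phi] survives. *)
Lemma antidual_mul1l Phi : antidual Phi -> antidual_mul (@antidual_one R W) Phi =1 Phi.
Proof.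
have h1 := antidual_one_antidual.
move=> h s; elim/sym_mul_ind: s Phi h => [|w s IH|c s t IHs IHt] Phi h.
- by rewrite antidual_mul1 // antidual_one1 mul1r.
- rewrite antidual_mul_in // IH; last exact: contraction_antidual.
  rewrite (antidual_mul_ext Phi (Phi' := fun=> 0)) ?antidual_mul0l ?add0r //.
  by move=> t; exact: antidual_one_in.
- by rewrite (antidualP (antidual_mul_antidual h1 h)) IHs // IHt // (antidualP h).
Qed.

Lemma antidual_exp_antidual Phi n : antidual Phi -> antidual (antidual_exp Phi n).
Proof.
move=> h; elim: n => [|n IH]; first exact: antidual_one_antidual.
exact: antidual_mul_antidual.
Qed.

End AntidualAlgebra.

(** * The Gaussian as a terminating exponential series *)

Section GaussianTheory.
Variables (R : realType) (W : preHilbertType R).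
Implicit Types (Phi Psi : sym W -> R[i]) (s t : sym W) (v w : W).

Lemma annihilatorD v s t : annihilator v (s + t) = annihilator v s + annihilator v t.
Proof. exact: (sym_derD (bra v)). Qed.

Lemma annihilatorZ v c s : annihilator v (c *: s) = c *: annihilator v s.
Proof. exact: (sym_derZ (bra v)). Qed.

Lemma annihilator_in_mul v w s :
  annihilator v (sym_in w * s) = <<v | w>> *: s + sym_in w * annihilator v s.
Proof. by rewrite annihilatorM annihilator_in mulr_algl. Qed.

Lemma annihilator_antilinear s : antilinear (fun v => annihilator v s).
Proof.
move=> c v w; elim/sym_mul_ind: s => [|u s IH|d s t IHs IHt].
- by rewrite !annihilator1 scaler0 addr0.
- rewrite !annihilator_in_mul IH ipDl ipZl scalerDl mulrDr scalerDr scalerA.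
  by rewrite -scalerAr addrACA.
- rewrite !annihilatorD !annihilatorZ IHs IHt !scalerDr !scalerA mulrC.
  by rewrite [_ + _ + (_ + _)]addrACA.
Qed.

Lemma creator'_antidual v Phi : antidual Phi -> antidual (creator' v Phi).
Proof. by move=> h c s t; rewrite /creator' annihilator_linear h. Qed.

(** On [SW'] a creator is multiplication by the functional [<. | v>], so it passes through products.
    The proof is an induction on the argument, driven by the commutation relation of creators with
    contractions. *)
Lemma creator'_mul v Phi Psi : antidual Phi -> antidual Psi ->
  antidual_mul (creator' v Phi) Psi =1 creator' v (antidual_mul Phi Psi).
Proof.
move=> h h' s.
elim/sym_mul_ind: s Phi Psi h h' => [|w s IH|c s t IHs IHt] Phi Psi h h'.
- rewrite antidual_mul1 //; last exact: creator'_antidual.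
  rewrite /creator' annihilator1 (antilinear0 h) mul0r.
  by rewrite (antilinear0 (antidual_mul_antidual h h')).
- have hw := contraction_antidual w h; have hw' := contraction_antidual w h'.
  rewrite antidual_mul_in //; last exact: creator'_antidual.
  (* The commutation relation: contracting [creator' v Phi] by [w] produces an extra multiple of
     [Phi]. *)
  rewrite (antidual_mul_ext (Phi' := fun t =>
      <<v | w>>^* * Phi t + creator' v (contraction w Phi) t)); last first.
    by move=> t; rewrite /contraction /creator' annihilator_in_mul (antidualP h).
  rewrite antidual_mulPl //; last exact: creator'_antidual.
  rewrite !IH // /creator' annihilator_in_mul.
  rewrite (antidualP (antidual_mul_antidual h h')).
  by rewrite antidual_mul_in // addrA.
- have hc := creator'_antidual v h.
  rewrite (antidualP (antidual_mul_antidual hc h')) IHs // IHt //.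
  by rewrite (antidualP (creator'_antidual v (antidual_mul_antidual h h'))).
Qed.

Section Gaussian.
Variable Z : W -> W.
Hypothesis Zs : ip_symmetric Z.

Lemma zeta_antidual : antidual (zeta Z).
Proof. by have [] := zetaP Zs. Qed.

Lemma zeta_pow n s : n != 2%N -> sym_pow n s -> zeta Z s = 0.
Proof. by move=> n2 hs; have [_ h _] := zetaP Zs; exact: h hs. Qed.

(** Both sides live in degree one, where they equal [<. | Z w>]; they are compared on words of
    length 0, 1 and at least 2. *)
Lemma contraction_zeta w :
  contraction w (zeta Z) =1 creator' (Z w) (@antidual_one R W).
Proof.
have h1 := @antidual_one_antidual R W; have hz := zeta_antidual.
have hc := contraction_antidual w hz; have hc' := creator'_antidual (Z w) h1.
move=> s; have [l ->] := sym_span s; rewrite !antidual_sum //.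
apply: eq_bigr => -[c ws] _ /=; congr (_ * _).
case: ws => [|x [|y ws]].
- rewrite big_nil /contraction /creator' annihilator1 (antilinear0 h1) mulr1.
  by have := zeta_pow (n := 1) isT (sym_pow_prod [:: w]); rewrite big_seq1.
- rewrite big_seq1 /contraction /creator' annihilator_in (antidualZ h1).
  by rewrite antidual_one1 mulr1 -ip_conj; have [_ _ ->] := zetaP Zs.
- have := zeta_pow (n := (size ws).+3) isT (sym_pow_prod [:: w, x, y & ws]).
  rewrite /contraction big_cons => ->.
  rewrite /creator' big_cons annihilator_in_mul big_cons (antidualP h1) !antidual_one_in.
  by rewrite mulr0 addr0.
Qed.

Lemma zeta1 : zeta Z 1 = 0.
Proof.
by have := zeta_pow (n := 0) isT (sym_pow_prod [::]); rewrite big_nil.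
Qed.

(* For n = 0 the junk index n.-1 = 0 is harmless, as the factor n%:R vanishes. *)
Lemma antidual_exp_in n w s :
  antidual_exp (zeta Z) n (sym_in w * s) =
  n%:R * antidual_exp (zeta Z) n.-1 (annihilator (Z w) s).
Proof.
have h1 := @antidual_one_antidual R W; have hz := zeta_antidual.
have hE m : antidual (antidual_exp (zeta Z) m) by exact: antidual_exp_antidual.
elim: n w s => [|n IH] w s; first by rewrite mul0r; exact: antidual_one_in.
rewrite [LHS]antidual_mul_in // (antidual_mul_ext _ (contraction_zeta w)).
rewrite creator'_mul // {1}/creator' antidual_mul1l // -/(antidual_exp _ n).
have hE' : antidual (creator' (Z w) (antidual_exp (zeta Z) n.-1)).
  exact: creator'_antidual.
(* In the second Leibniz term the contracted power moves to the front, where the induction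
   hypothesis and linearity apply. The summand [0] below only fits the shape of [antidual_mulPl]. *)
rewrite antidual_mulC //; last exact: contraction_antidual.
have h0 := @antidual_zero R W.
rewrite (antidual_mul_ext (Phi' := fun t =>
  n%:R * creator' (Z w) (antidual_exp (zeta Z) n.-1) t + 0)); last first.
  by move=> t; rewrite addr0; exact: IH.
rewrite antidual_mulPl // antidual_mul0l // addr0 creator'_mul // /creator'.
rewrite antidual_mulC // -[n.+1%:R]natr1 mulrDl mul1r addrC.
(* For positive [n] the remaining factor [zeta Z] completes the power [n]; for [n = 0] both
   coefficients are zero. *)
by case: n {IH hE'} => [|n] //=; rewrite ![0 * _]mul0r.
Qed.

Lemma antidual_expS1 n : antidual_exp (zeta Z) n.+1 1 = 0.
Proof.
rewrite [LHS]antidual_mul1 ?zeta1 ?mul0r //; first exact: zeta_antidual.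
exact/antidual_exp_antidual/zeta_antidual.
Qed.

Definition gaussian_term n s : R[i] := n`!%:R^-1 * antidual_exp (zeta Z) n s.

Lemma gaussian_term_antidual n : antidual (gaussian_term n).
Proof.
have h := antidual_exp_antidual n zeta_antidual.
by move=> c s t; rewrite /gaussian_term (antidualP h) /GRing.scale /=; ring.
Qed.

Lemma gaussian_termS n w s :
  gaussian_term n.+1 (sym_in w * s) = gaussian_term n (annihilator (Z w) s).
Proof.
rewrite /gaussian_term antidual_exp_in /= factS natrM invfM mulrACA.
by rewrite mulVf ?pnatr_eq0 // mul1r.
Qed.

(** The filtration by degree at most [k]. Its clauses follow [sym_mul_ind], which avoids homogeneous
    components; allowing [1] at every level makes it increasing in [k]. *)
Inductive sym_filtered : nat -> sym W -> Prop :=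
| sym_filtered1 k : sym_filtered k 1
| sym_filteredP k c s t :
    sym_filtered k s -> sym_filtered k t -> sym_filtered k (c *: s + t)
| sym_filteredM k w s : sym_filtered k s -> sym_filtered k.+1 (sym_in w * s).

Lemma sym_filtered0 k : sym_filtered k 0.
Proof. by rewrite -(addNr 1) -scaleN1r; apply: sym_filteredP; constructor. Qed.

Lemma sym_filtered_leq k m s : (k <= m)%N -> sym_filtered k s -> sym_filtered m s.
Proof.
move=> km hs; elim: hs m km => {k s} [k|k c s t _ IHs _ IHt|k w s _ IH] m km.
- exact: sym_filtered1.
- by apply: sym_filteredP; [exact: IHs|exact: IHt].
- by case: m km => // m km; apply: sym_filteredM; exact: IH.
Qed.

(** The degree in fact drops, but the bound [k] suffices: termwise vanishing gains its step from the
    generator that is removed. *)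
Lemma sym_filtered_annihilator k v s :
  sym_filtered k s -> sym_filtered k (annihilator v s).
Proof.
elim=> {k s} [k|k c s t _ IHs _ IHt|k w s hs IH].
- by rewrite annihilator1; exact: sym_filtered0.
- by rewrite annihilator_linear; exact: sym_filteredP.
- rewrite annihilator_in_mul; apply: sym_filteredP; last exact: sym_filteredM.
  exact: sym_filtered_leq hs.
Qed.

Lemma sym_filtered_exists s : exists k, sym_filtered k s.
Proof.
elim/sym_mul_ind: s => [|w s [k hk]|c s t [k hk] [m hm]].
- by exists 0%N; exact: sym_filtered1.
- by exists k.+1; exact: sym_filteredM.
- exists (maxn k m); apply: sym_filteredP; apply: sym_filtered_leq.
  + exact: leq_maxl. + exact: hk. + exact: leq_maxr. + exact: hm.
Qed.

(** Removing a generator by [gaussian_termS] lowers both the index and the degree bound by one. The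
    induction on [k] is strong because [annihilator (Z w) s] is no subterm of the derivation of the
    bound. *)
Lemma gaussian_term_eq0 k s n :
  sym_filtered k s -> (k < n)%N -> gaussian_term n s = 0.
Proof.
elim/ltn_ind: k s n => k IHk s n hs.
elim: hs IHk n => {k s} [k|k c s t _ IHs _ IHt|k w s hs _] IHk [|n] // kn.
- by rewrite /gaussian_term antidual_expS1 mulr0.
- by rewrite (antidualP (gaussian_term_antidual _)) IHs // IHt // mulr0 addr0.
- rewrite gaussian_termS; apply: (IHk k) => //.
  exact: sym_filtered_annihilator.
Qed.

(** All terms of index above [k] vanish at [s], so the partial sums are eventually constant and the
    limit is one of them. *)
Lemma gaussianE k s n : sym_filtered k s -> (k < n)%N ->
  gaussian Z s = \sum_(0 <= i < n) gaussian_term i s.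
Proof.
move=> hs kn; rewrite /gaussian; apply: (@cvg_lim R[i]^o); first exact: norm_hausdorff.
apply: cvg_near_cst; near=> m.
rewrite /series /= (@big_cat_nat _ _ _ n) //=; last by near: m; exists n.
rewrite [X in _ + X]big_nat_cond [X in _ + X]big1 ?addr0 // => i /andP[/andP[ni _] _].
by rewrite -/(gaussian_term i s) (gaussian_term_eq0 hs) // (leq_trans kn).
Unshelve. all: by end_near.
Qed.

Lemma gaussian_antidual : antidual (gaussian Z).
Proof.
move=> c s t; have [k hk] := sym_filtered_exists s.
have [m hm] := sym_filtered_exists t.
have ks := sym_filtered_leq (leq_maxl k m) hk.
have kt := sym_filtered_leq (leq_maxr k m) hm.
rewrite (gaussianE ks (ltnSn _)) (gaussianE kt (ltnSn _)).
rewrite (gaussianE (sym_filteredP c ks kt) (ltnSn _)) scaler_sumr -big_split /=.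
by apply: eq_bigr => i _; rewrite (antidualP (gaussian_term_antidual i)).
Qed.

Lemma gaussian1 : gaussian Z 1 = 1.
Proof.
rewrite (gaussianE (sym_filtered1 0) (ltnSn _)) big_nat1 /gaussian_term.
by rewrite [antidual_exp _ 0 _]antidual_one1 invr1 mulr1.
Qed.

(** The term of index 0 vanishes on a multiple of a generator, and [gaussian_termS] shifts every
    other term down by one. *)
Lemma gaussian_in w s : gaussian Z (sym_in w * s) = gaussian Z (annihilator (Z w) s).
Proof.
have [k hk] := sym_filtered_exists s.
rewrite (gaussianE (sym_filteredM w hk) (ltnSn _)).
rewrite (gaussianE (sym_filtered_annihilator (Z w) hk) (ltnSn _)).
rewrite big_nat_recl // {1}/gaussian_term [antidual_exp _ 0 _]antidual_one_in mulr0 add0r.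
by apply: eq_bigr => i _; exact: gaussian_termS.
Qed.

End Gaussian.
End GaussianTheory.

(** * Surjectivity of operators bounded below *)

Section SquaredNorm.
Variables (R : realType) (W : preHilbertType R).
Implicit Types x y z a b : W.

Lemma ipN x y : <<x | - y>> = - <<x | y>>.
Proof. by rewrite -scaleN1r ipZ mulN1r. Qed.
Lemma ipNl x y : <<- x | y>> = - <<x | y>>.
Proof. by rewrite ip_conj ipN rmorphN /= -ip_conj. Qed.
Lemma ipBl x y z : <<x - y | z>> = <<x | z>> - <<y | z>>.
Proof. by rewrite ipDl ipNl. Qed.
Lemma ipB x y z : <<x | y - z>> = <<x | y>> - <<x | z>>.
Proof. by rewrite ipD ipN. Qed.

Lemma ip_ext x y : (forall z, <<x | z>> = <<y | z>>) -> x = y.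
Proof.
move=> h; apply/eqP; rewrite -subr_eq0; apply/eqP/ip_eq0.
by rewrite ipBl h subrr.
Qed.

(** The values lie in [R] rather than [R[i]], so that the estimates are real inequalities. *)
Definition sqnorm x : R := complex.Re <<x | x>>.

Lemma ipxx x : <<x | x>> = (sqnorm x)%:C.
Proof.
have := ip_ge0 x; rewrite /sqnorm; case: <<x | x>> => r s.
by rewrite lecE /= => /andP[/eqP -> _].
Qed.

Lemma sqnorm_ge0 x : 0 <= sqnorm x.
Proof. by rewrite -lecR -ipxx ip_ge0. Qed.

Lemma sqnormBZ a b (c : R[i]) : sqnorm (a - c *: b) =
  sqnorm a - 2 * complex.Re (c * <<a | b>>)
  + (complex.Re c ^+ 2 + complex.Im c ^+ 2) * sqnorm b.
Proof.
rewrite /sqnorm !(ipBl, ipB, ipZ, ipZl) (ip_conj a b) [<<b | b>>]ipxx.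
by case: <<a | b>> => p q; case: c => s t; case: <<a | a>> => u v /=; ring.
Qed.

Lemma parallelogram a b :
  sqnorm (a - b) = 2 * sqnorm a + 2 * sqnorm b - sqnorm (a + b).
Proof.
rewrite /sqnorm !(ipBl, ipB, ipD, ipDl).
case: <<a | a>> => ? ?; case: <<a | b>> => ? ?; case: <<b | a>> => ? ?.
by case: <<b | b>> => ? ? /=; ring.
Qed.

Lemma sqnormZ (r : R) x : sqnorm (r%:C *: x) = r ^+ 2 * sqnorm x.
Proof. by rewrite /sqnorm ipZ ipZl ipxx /=; ring. Qed.

Definition sqmod (z : R[i]) : R := complex.Re z ^+ 2 + complex.Im z ^+ 2.

Lemma sqmod_eq0 (z : R[i]) : sqmod z <= 0 -> z = 0.
Proof.
case: z => p q; rewrite /sqmod /= => h.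
have : p ^+ 2 + q ^+ 2 == 0 by rewrite eq_le h addr_ge0 ?sqr_ge0.
rewrite paddr_eq0 ?sqr_ge0 // !sqrf_eq0 => /andP[/eqP -> /eqP ->].
by [].
Qed.

Lemma sqmodD (z w : R[i]) : sqmod (z + w) <= 2 * sqmod z + 2 * sqmod w.
Proof.
case: z w => [p q] [r s]; rewrite /sqmod /=.
have := sqr_ge0 (p - r); have := sqr_ge0 (q - s); nra.
Qed.

(* The competitor [a - t <a|b>^* b] with [t = 1 / (1 + |b|^2)]. *)
Lemma near_minimal_ip a b (d e : R) :
  (forall c : R[i], d <= sqnorm (a - c *: b)) -> sqnorm a <= d + e ->
  sqmod <<a | b>> <= e * (1 + sqnorm b).
Proof.
move=> hd ha; have Q0 := sqnorm_ge0 b.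
have Q1 : 0 < 1 + sqnorm b by rewrite ltr_pwDl.
set t := (1 + sqnorm b)^-1; have t0 : 0 < t by rewrite invr_gt0.
have tQ : t * (1 + sqnorm b) = 1 by rewrite mulVf // gt_eqF.
set m := sqmod _; have m0 : 0 <= m by rewrite addr_ge0 ?sqr_ge0.
(* The last two terms add up to [t ^+ 2 * sqnorm b * m], grouped so that [tQ] can be substituted. *)
have h : d <= sqnorm a - 2 * (t * m) + t * (t * (1 + sqnorm b)) * m - t ^+ 2 * m.
  apply: le_trans (hd (t%:C * <<a | b>>^*)) _; rewrite sqnormBZ /m /sqmod.
  by case: <<a | b>> => p q /=; rewrite le_eqVlt; apply/orP; left; apply/eqP; ring.
have {}h : t * m <= e.
  have : 0 <= t ^+ 2 * m by rewrite mulr_ge0 ?sqr_ge0.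
  by move: h; rewrite tQ; lra.
have -> : m = t * m * (1 + sqnorm b) by rewrite mulrAC tQ mul1r.
by rewrite ler_wpM2r // ltW.
Qed.

(** Take [d = 0] in [near_minimal_ip], a lower bound for every squared norm. The result is a weak
    Cauchy-Schwarz inequality, used for passing to limits. *)
Lemma sqmod_ip_le a b : sqmod <<a | b>> <= sqnorm a * (1 + sqnorm b).
Proof.
by apply: (@near_minimal_ip _ _ 0) => [c|]; rewrite ?add0r //; exact: sqnorm_ge0.
Qed.

End SquaredNorm.

(** Completeness of [V] in terms of [sqnorm]: the norm takes values in [R[i]], but a positive
    element of [R[i]] is real. *)
Lemma sqnorm_cauchy_cvg (R : realType) (V : hilbertType R) (u : nat -> V) :
  (forall e : R, 0 < e -> exists N, forall n m, (N <= n)%N -> (N <= m)%N ->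
    sqnorm (u n - u m) < e) ->
  exists x, forall e : R, 0 < e ->
    exists N, forall n, (N <= n)%N -> sqnorm (x - u n) < e.
Proof.
have normE (v : V) (e : R) : 0 < e -> (`|v| < e%:C) = (sqnorm v < e ^+ 2).
  move=> e0; rewrite -(@ltr_pXn2r _ 2) ?nnegrE ?normr_ge0 ?lecR ?(ltW e0) //.
  by rewrite sqr_norm_ip ipxx -rmorphXn /= ltcR.
move=> hu; have posE (e : R[i]) : 0 < e -> exists2 r : R, 0 < r & e = r%:C.
  by case: e => r s; rewrite ltcE /= => /andP[/eqP -> r0]; exists r.
have cu : cauchy (u @ \oo).
  apply: cauchy_exP => e /posE[r r0 ->].
  have [N hN] := hu _ (exprn_gt0 2 r0); exists (u N), N => // n /= Nn.
  by rewrite -ball_normE /= normE // hN.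
have /cauchy_cvg/cvg_ex[x xu] := cu; exists x => e e0.
have /cvgrPdist_lt /(_ (Num.sqrt e)%:C) := xu.
rewrite ltcR sqrtr_gt0 e0 => /(_ isT)[N _ hN]; exists N => n Nn.
by have := hN n Nn; rewrite /= normE ?sqrtr_gt0 // sqr_sqrtr // ltW.
Qed.

Section AdjointPair.
Variables (R : realType) (V : hilbertType R) (C D : V -> V).
Hypothesis adjCD : forall x y, <<C x | y>> = <<x | D y>>.

(** Pairing with an arbitrary vector moves [C] to the other slot. Both [C_ g] and its inverse obtain
    their linearity in this way. *)
Lemma adjoint_linear : linear C.
Proof.
by move=> c x y; apply: ip_ext => z; rewrite !(ipDl, ipZl, adjCD).
Qed.

(* No continuity of C is assumed: a minimizing sequence for |y - C x| is
   Cauchy because C is bounded below, and the adjoint passes to its limit. *)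
Lemma adjoint_surjective :
  (forall x, sqnorm x <= sqnorm (C x)) -> (forall y, D y = 0 -> y = 0) ->
  forall y, exists x, C x = y.
Proof.
move=> C_ge D_inj y.
have CP c x z : C (c *: x + z) = c *: C x + C z by rewrite adjoint_linear.
have CD x z : C (x + z) = C x + C z by rewrite -[x]scale1r CP !scale1r.
have CB x z : C (x - z) = C x - C z.
  by rewrite addrC -scaleN1r CP scaleN1r addrC.
pose E := [set sqnorm (y - C x) | x in setT].
have E_inf : has_inf E.
  split; first by exists (sqnorm (y - C 0)), 0.
  by exists 0 => _ [x _ <-]; exact: sqnorm_ge0.
have dE x : inf E <= sqnorm (y - C x).
  by apply: ge_inf; [exact: (proj2 E_inf) | exists x].
have /choice[u hu] : forall n, exists x, sqnorm (y - C x) < inf E + n.+1%:R^-1.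
  move=> n; have n0 : 0 < n.+1%:R^-1 :> R by rewrite invr_gt0 ltr0n.
  by have [_ [x _ <-] ?] := inf_adherent n0 E_inf; exists x.
have hu' n N : (N <= n)%N -> sqnorm (y - C (u n)) <= inf E + N.+1%:R^-1.
  move=> Nn; apply: le_trans (ltW (hu n)) _.
  by rewrite lerD2l lef_pV2 ?posrE ?ltr0n // ler_nat ltnS.
have small (e : R) : 0 < e -> exists N : nat, N.+1%:R^-1 < e.
  by move=> /ltr_add_invr[N]; rewrite add0r; exists N.
have [|x hx] := @sqnorm_cauchy_cvg R V u.
  (* With error [k] in both terms, the parallelogram identity gives at most
     [4 * (inf E + k) - 4 * inf E = 4 * k]. *)
  move=> e e0; have [|N hN] := small (e / 4); first by rewrite divr_gt0.
  exists N => n m Nn Nm; apply: le_lt_trans (C_ge _) _.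
  have -> : C (u n - u m) = (y - C (u m)) - (y - C (u n)).
    by rewrite CB opprB [RHS]addrC addrA subrK.
  rewrite parallelogram.
  (* The sum is twice the residual of the midpoint, whose squared norm is at least [inf E]. *)
  have -> : (y - C (u m)) + (y - C (u n)) =
      (2 : R)%:C *: (y - C ((2^-1 : R)%:C *: (u m + u n))).
    rewrite scalerBr -[(2^-1)%:C *: _]addr0 CP -[in RHS](subrr 0) CB subrr addr0.
    rewrite scalerA -rmorphM mulfV ?pnatr_eq0 // rmorph1 scale1r CD opprD addrACA.
    by rewrite rmorph_nat scaler_nat mulr2n.
  rewrite sqnormZ; have := hu' n N Nn; have := hu' m N Nm.
  have := dE ((2^-1 : R)%:C *: (u m + u n)); move: hN e0.
  by move: N.+1%:R^-1 (inf E) => k d; lra.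
(* The residual [y - C x] is shown to be orthogonal to the range of [C], hence to be killed by the
   injective map [D]. *)
exists x; apply/eqP; rewrite eq_sym -subr_eq0; apply/eqP/D_inj/ip_ext => z.
rewrite ip0l ip_conj -adjCD -ip_conj; apply: sqmod_eq0.
(* Split [<y - C x | C z>] at [u n]: the first summand is small by near-minimality, the second,
   moved to [<u n - x | D (C z)>], by convergence. [K] adds up the coefficients of both bounds, with
   the factor 2 of [sqmodD]; a positive squared modulus would then be less than itself. *)
set K := 2 * (1 + sqnorm (C z)) + 2 * (1 + sqnorm (D (C z))).
have K0 : 0 < K.
  by have := sqnorm_ge0 (C z); have := sqnorm_ge0 (D (C z)); rewrite /K; lra.
rewrite leNgt; apply/negP => p0; have e0 := divr_gt0 p0 K0.
have [N hN] := small _ e0; have [M hM] := hx _ e0.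
set n := maxn N M; have {}hM := hM n (leq_maxr _ _).
have hn := hu' n N (leq_maxl _ _).
have : sqmod <<y - C (u n) | C z>> <= N.+1%:R^-1 * (1 + sqnorm (C z)).
  apply: (@near_minimal_ip _ _ _ _ (inf E)) hn => c.
  by rewrite -addrA -opprD [C _ + _]addrC -CP.
have := sqmod_ip_le (u n - x) (D (C z)).
have -> : sqnorm (u n - x) = sqnorm (x - u n).
  by rewrite -opprB -scaleN1r -(rmorphN1 (real_complex R)) sqnormZ sqrrN expr1n mul1r.
have := sqmodD <<y - C (u n) | C z>> <<u n - x | D (C z)>>.
rewrite -adjCD -ipDl CB addrA subrK.
move: p0 hM hN e0; set e := sqmod _ / K => p0 hM hN e0 h1 h2 h3.
have : sqmod <<y - C x | C z>> = e * K by rewrite /e divfK // gt_eqF.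
rewrite /K; have := sqnorm_ge0 (C z); have := sqnorm_ge0 (D (C z)).
set A := sqnorm (C z) in h3 *; set B := sqnorm (D (C z)) in h2 *.
move=> A0 B0 hE.
have h3' : N.+1%:R^-1 * (1 + A) < e * (1 + A) by rewrite ltr_pM2r //; lra.
have h2' : sqnorm (x - u n) * (1 + B) < e * (1 + B) by rewrite ltr_pM2r //; lra.
by move: h1 h2 h3 hE h2' h3'; move: N.+1%:R^-1 => k; lra.
Qed.

End AdjointPair.

(** * Symplectic maps and the complexification *)

Section SymplecticForm.
Variables (R : realType) (V : preHilbertType R).
Implicit Types x y z : V.

Lemma JJ x : J (J x) = - x.
Proof. by rewrite /J scalerA -expr2 sqr_i scaleN1r. Qed.
Lemma JD x y : J (x + y) = J x + J y.
Proof. exact: scalerDr. Qed.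
Lemma JN x : J (- x) = - J x.
Proof. exact: scalerN. Qed.
Lemma JZ c x : J (c *: x) = c *: J x.
Proof. by rewrite /J !scalerA mulrC. Qed.

Lemma OmegaJ x y : Omega x (J y) = complex.Re <<x | y>>.
Proof. by rewrite /Omega /J ipZ; case: <<x | y>> => ? ? /=; ring. Qed.
Lemma OmegaJl x y : Omega (J x) y = - complex.Re <<x | y>>.
Proof. by rewrite /Omega /J ipZl; case: <<x | y>> => ? ? /=; ring. Qed.
Lemma OmegaC x y : Omega x y = - Omega y x.
Proof. by rewrite /Omega ip_conj; case: <<y | x>>. Qed.
Lemma OmegaD x y z : Omega x (y + z) = Omega x y + Omega x z.
Proof. by rewrite /Omega ipD; case: <<x | y>>; case: <<x | z>>. Qed.
Lemma OmegaDl x y z : Omega (x + y) z = Omega x z + Omega y z.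
Proof. by rewrite /Omega ipDl; case: <<x | z>>; case: <<y | z>>. Qed.
Lemma OmegaN x y : Omega x (- y) = - Omega x y.
Proof. by rewrite /Omega ipN; case: <<x | y>>. Qed.
Lemma OmegaNl x y : Omega (- x) y = - Omega x y.
Proof. by rewrite /Omega ipNl; case: <<x | y>>. Qed.

Lemma halfE : (2%:R^-1 : R[i]) = (2^-1)%:C.
Proof. by rewrite -[2%:R](rmorph_nat (real_complex R)) -fmorphV. Qed.

Lemma Omega_half x y : Omega x (2%:R^-1 *: y) = 2^-1 * Omega x y.
Proof. by rewrite halfE /Omega ipZ; case: <<x | y>> => ? ? /=; ring. Qed.
Lemma Omega_halfl x y : Omega (2%:R^-1 *: x) y = 2^-1 * Omega x y.
Proof. by rewrite OmegaC Omega_half OmegaC mulrN opprK. Qed.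

(** The imaginary part of the inner product is [Omega x y] and the real part is [Omega x (J y)], so
    adjoint relations need only be proved for [Omega]. *)
Lemma ip_Omega x y x' y' : Omega x y = Omega x' y' ->
  Omega x (J y) = Omega x' (J y') -> <<x | y>> = <<x' | y'>>.
Proof.
rewrite !OmegaJ /Omega; case: <<x | y>> => a b; case: <<x' | y'>> => c d /=.
by move=> -> ->.
Qed.

Lemma half_double x : 2%:R^-1 *: (x + x) = x.
Proof. by rewrite -mulr2n -[x *+ 2]scaler_nat scalerA mulVf ?pnatr_eq0 // scale1r. Qed.

End SymplecticForm.

(** * Linear and antilinear parts of a symplectic map *)

Section SymplecticTheory.
Variables (R : realType) (V : hilbertType R).
Implicit Types (g : V -> V) (x y v : V).

Lemma inverse_Sp g : Sp g -> Sp (inverse g).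
Proof.
move=> [gP gbij gO]; have [gK Kg] := inverseK gbij; split.
- by move=> r x y; apply: (can_inj gK); rewrite gP !Kg.
- by exists g.
- by move=> x y; rewrite -gO !Kg.
Qed.

Lemma inverse_inverse g : Sp g -> inverse (inverse g) = g.
Proof.
move=> hg; have [_ /inverseK[gK Kg] _] := hg.
have [_ /inverseK[hK Kh] _] := inverse_Sp hg.
by apply/funext => x; apply: (can_inj Kg); rewrite gK Kh.
Qed.

Lemma Sp_add g : Sp g -> {morph g : x y / x + y}.
Proof. by move=> [gP _ _] x y; have := gP 1 x y; rewrite rmorph1 !scale1r. Qed.

Lemma additive_opp (f : V -> V) :
  {morph f : x y / x + y} -> {morph f : x / - x}.
Proof.
move=> fD x; apply: (addrI (f x)); rewrite -fD !subrr.
by apply: (addrI (f 0)); rewrite -fD !addr0.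
Qed.

Lemma Sp_opp g : Sp g -> {morph g : x / - x}.
Proof. by move=> /Sp_add/additive_opp. Qed.

Lemma Omega_adj g x y : Sp g -> Omega (g x) y = Omega x (inverse g y).
Proof. by move=> [_ /inverseK[gK Kg] gO]; rewrite -{1}(Kg y) gO. Qed.

Lemma CA_sum g v : C_ g v + A_ g v = g v.
Proof. by rewrite /C_ /A_ -scalerDr addrACA addNr addr0 half_double. Qed.

Lemma C_J g v : Sp g -> C_ g (J v) = J (C_ g v).
Proof.
by move=> hg; rewrite /C_ JJ (Sp_opp hg) JN opprK [RHS]JZ JD JN JJ opprK addrC.
Qed.

Lemma A_J g v : Sp g -> A_ g (J v) = - J (A_ g v).
Proof.
move=> hg; rewrite /A_ JJ (Sp_opp hg) JN [X in _ = - X]JZ JD JJ.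
by rewrite -[RHS]scalerN opprB.
Qed.

(** For [Omega] the adjoint of [g] is its inverse and that of [J] is [- J], so the two signs in the
    transpose of [J g J] cancel. *)
Lemma C_Omega g x y : Sp g -> Omega (C_ g x) y = Omega x (C_ (inverse g) y).
Proof.
move=> hg; rewrite /C_ Omega_halfl Omega_half OmegaDl OmegaD OmegaNl OmegaN.
rewrite OmegaJl -OmegaJ !(Omega_adj _ _ hg) opprK; congr (_ * (_ + _)).
by rewrite OmegaJ OmegaJl.
Qed.

Lemma A_Omega g x y : Sp g -> Omega (A_ g x) y = Omega x (A_ (inverse g) y).
Proof.
move=> hg; rewrite /A_ Omega_halfl Omega_half OmegaDl OmegaD.
rewrite OmegaJl -OmegaJ !(Omega_adj _ _ hg); congr (_ * (_ + _)).
by rewrite OmegaJ OmegaJl opprK.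
Qed.

Lemma C_adj g : Sp g -> forall x y, <<C_ g x | y>> = <<x | C_ (inverse g) y>>.
Proof.
move=> hg x y; have hh := inverse_Sp hg.
by apply: ip_Omega; rewrite C_Omega // C_J.
Qed.

(** As [A_ g] anticommutes with [J], moving it across negates the real part of the pairing and keeps
    the imaginary part; hence the sign and the exchanged slots. *)
Lemma A_adj g : Sp g -> forall x y, <<A_ g x | y>> = - <<A_ (inverse g) y | x>>.
Proof.
move=> hg x y; have hh := inverse_Sp hg; rewrite -ipNl.
apply: ip_Omega; first by rewrite A_Omega // OmegaNl OmegaC.
rewrite A_Omega // A_J // OmegaN OmegaNl; congr (- _).
by rewrite !OmegaJ ip_conj; case: <<_ | _>>.
Qed.

Lemma C_linear g : Sp g -> linear (C_ g).
Proof. by move=> hg; exact: (adjoint_linear (C_adj hg)). Qed.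

Lemma A_antilinear g : Sp g -> antilinear (A_ g).
Proof.
move=> hg c x y; apply: ip_ext => z.
rewrite (A_adj hg) ip_linear [RHS]ipDl (ipZl _ (A_ g x)) conjcK.
by rewrite !(A_adj hg) opprD mulrN.
Qed.

Lemma linear_morphD (f : V -> V) : linear f -> {morph f : x y / x + y}.
Proof. by move=> fP x y; rewrite -[x]scale1r fP !scale1r. Qed.

(* The complex-linear and antilinear parts of [inverse g \o g = id]. *)
Lemma CA_inverse g v : Sp g ->
  C_ (inverse g) (C_ g v) + A_ (inverse g) (A_ g v) = v /\
  C_ (inverse g) (A_ g v) + A_ (inverse g) (C_ g v) = 0.
Proof.
move=> hg; have hh := inverse_Sp hg; have [_ /inverseK[gK _] _] := hg.
have CD := linear_morphD (C_linear hh); have AD := antilinearD (A_antilinear hh).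
pose F x := C_ (inverse g) (C_ g x) + A_ (inverse g) (A_ g x).
pose G x := C_ (inverse g) (A_ g x) + A_ (inverse g) (C_ g x).
have FG x : F x + G x = x.
  rewrite -[RHS]gK -[RHS]CA_sum -[in RHS](CA_sum g x) CD AD /F /G.
  by rewrite addrACA [A_ _ (A_ g x) + _]addrC.
have CN := additive_opp CD; have AN := additive_opp AD.
have FJ x : F (J x) = J (F x) by rewrite /F !C_J // !A_J // AN !A_J // opprK JD.
have GJ x : G (J x) = - J (G x).
  by rewrite /G !C_J // !A_J // CN !C_J // JD opprD.
(* Evaluate [FG] at [J x]: [F] commutes with [J] and [G] anticommutes with it. *)
have {}FG' x : F x - G x = x.
  have := FG (J x); rewrite FJ GJ -JN -JD => /(congr1 (@J R V)).
  by rewrite !JJ => /oppr_inj.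
have G0 : G v = 0.
  have addBB (a b : V) : b + b = (a + b) - (a - b).
    by rewrite opprB [a + b]addrC addrACA subrr addr0.
  rewrite -[LHS]half_double (addBB (F v)).
  by rewrite FG FG' subrr scaler0.
by split=> //; have := FG v; rewrite G0 addr0.
Qed.

(** Pair the first identity of [CA_inverse] with [v]; the adjoint of [A_ g] carries a minus sign,
    which moves its term to the other side. *)
Lemma sqnorm_C g v : Sp g -> sqnorm (C_ g v) = sqnorm v + sqnorm (A_ g v).
Proof.
move=> hg; have [h _] := CA_inverse v hg.
have : <<C_ g v | C_ g v>> = <<v | v>> + <<A_ g v | A_ g v>>.
  rewrite (C_adj hg) [<<A_ g v | _>>]ip_conj (A_adj hg) rmorphN /= -ip_conj.
  by rewrite -ipB; congr ip; apply/eqP; rewrite eq_sym subr_eq h.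
by rewrite !ipxx -rmorphD => /(congr1 (@complex.Re R)).
Qed.

Lemma C_ge g v : Sp g -> sqnorm v <= sqnorm (C_ g v).
Proof. by move=> hg; rewrite sqnorm_C // lerDl sqnorm_ge0. Qed.

Lemma C_eq0 g v : Sp g -> C_ g v = 0 -> v = 0.
Proof.
move=> hg Cv; apply: ip_eq0; rewrite ipxx; congr (_%:C).
apply/eqP; rewrite eq_le sqnorm_ge0 andbT.
by apply: le_trans (C_ge v hg) _; rewrite Cv /sqnorm ip0.
Qed.

Lemma C_bijective g : Sp g -> bijective (C_ g).
Proof.
move=> hg; have hh := inverse_Sp hg.
have /choice[f fK] := adjoint_surjective (C_adj hg) (fun v => C_ge v hg)
  (fun v => @C_eq0 _ v hh).
exists f => // v; apply/eqP; rewrite -subr_eq0; apply/eqP/(C_eq0 hg).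
by rewrite addrC -scaleN1r C_linear // fK scaleN1r addNr.
Qed.

Lemma C_K g : Sp g -> cancel (C_ g) (inverse (C_ g)).
Proof. by move=> /C_bijective/inverseK[]. Qed.
Lemma C_inverseK g : Sp g -> cancel (inverse (C_ g)) (C_ g).
Proof. by move=> /C_bijective/inverseK[]. Qed.

Lemma inverse_C_adj g : Sp g -> forall x y,
  <<inverse (C_ g) x | y>> = <<x | inverse (C_ (inverse g)) y>>.
Proof.
move=> hg x y; have hh := inverse_Sp hg.
by rewrite -{2}(C_inverseK hg x) C_adj // C_inverseK.
Qed.

Lemma inverse_C_linear g : Sp g -> linear (inverse (C_ g)).
Proof. by move=> hg; exact: (adjoint_linear (inverse_C_adj hg)). Qed.

Lemma Z_antilinear g : Sp g -> antilinear (Z_ g).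
Proof. by move=> hg c x y; rewrite /Z_ A_antilinear // inverse_C_linear. Qed.

(** This is the antilinear part of [g \o inverse g = id], evaluated at
    [inverse (C_ (inverse g)) v]. *)
Lemma Z_E g v : Sp g -> Z_ g v = - A_ (inverse g) (inverse (C_ (inverse g)) v).
Proof.
move=> hg; have hh := inverse_Sp hg; apply: (can_inj (C_K hg)).
rewrite /Z_ C_inverseK // -scaleN1r -[_ *: _]addr0 C_linear //.
have C0 : C_ g 0 = 0.
  by apply: (addrI (C_ g 0)); rewrite -(linear_morphD (C_linear hg)) !addr0.
rewrite C0 addr0 scaleN1r; apply/eqP; rewrite -addr_eq0 addrC.
have [_] := CA_inverse (inverse (C_ (inverse g)) v) hh.
by rewrite inverse_inverse // C_inverseK // => ->.
Qed.

(** Rewriting one side by [Z_E] and taking adjoints of both factors gives back the definition of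
    [Z_ g] on the other. *)
Lemma Z_symmetric g : Sp g -> ip_symmetric (Z_ g).
Proof.
move=> hg x y; have hh := inverse_Sp hg.
rewrite {1}Z_E // ipN ip_conj A_adj // inverse_inverse // rmorphN opprK /= -ip_conj.
by rewrite inverse_C_adj // inverse_inverse.
Qed.

Lemma inverse_C_g g v : Sp g -> inverse (C_ g) (g v) = v + Z_ g v.
Proof.
move=> hg; rewrite -(CA_sum g v) (linear_morphD (inverse_C_linear hg)).
by rewrite C_K.
Qed.

End SymplecticTheory.

(** * The splitting of the complexification *)

Section Polarization.
Variables (R : realType) (V : preHilbertType R).
Implicit Types (u v w : V) (x y : cplx V) (s t : sym V).

Let r : R[i] := (Num.sqrt 2)^-1%:C.

Let rr : r * r = 2%:R^-1.
Proof. by rewrite /r -rmorphM -invfM -expr2 sqr_sqrtr ?ler0n // halfE. Qed.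

Let conj_r : r^* = r.
Proof. by rewrite /r /= /conjc oppr0. Qed.

Let cplxD (a b a' b' : V) : Cplx a b + Cplx a' b' = Cplx (a + a') (b + b').
Proof. by []. Qed.

(** The components of [x] in [V_+] and [V_-], pulled back to [V] along [vplus] and [vminus]. *)
Definition plus_coord x : V := r *: (cre x + J (cim x)).
Definition minus_coord x : V := r *: (cre x - J (cim x)).

Let JrZ v : J (r *: v) = r *: J v.
Proof. exact: JZ. Qed.
Let rrA v : r *: (r *: v) = 2%:R^-1 *: v.
Proof. by rewrite scalerA rr. Qed.
Let rDN u v : r *: u - r *: v = r *: (u - v).
Proof. by rewrite scalerBr. Qed.
Let rD u v : r *: u + r *: v = r *: (u + v).
Proof. by rewrite scalerDr. Qed.
Let addBB u v : (u + v) + (u - v) = u + u.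
Proof. by rewrite addrACA subrr addr0. Qed.
Let subBB u v : (u + v) - (u - v) = v + v.
Proof. by rewrite opprB [u + v]addrC addrACA subrr addr0. Qed.

Lemma plus_minus_coord x : x = vplus (plus_coord x) + vminus (minus_coord x).
Proof.
rewrite vplusE vminusE cplxD /plus_coord /minus_coord -/r; case: x => a b /=.
rewrite [- _ + _]addrC !JrZ !(rDN, rD) !rrA addBB JD JN JD JJ opprK.
by rewrite [J a + b]addrC -[J a - b]opprB opprK addBB !half_double.
Qed.

Lemma plus_coordE u w : plus_coord (vplus u + vminus w) = u.
Proof.
rewrite vplusE vminusE cplxD /plus_coord -/r /= [- _ + _]addrC !(rDN, rD) JrZ JD JN.
by rewrite !JJ opprK rD [- w + u]addrC rrA addBB half_double.
Qed.

Lemma minus_coordE u w : minus_coord (vplus u + vminus w) = w.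
Proof.
rewrite vplusE vminusE cplxD /minus_coord -/r /= [- _ + _]addrC !(rDN, rD) JrZ JD JN.
by rewrite !JJ opprK rDN [- w + u]addrC rrA subBB half_double.
Qed.

Let coordP c x y : c *: x + y =
  vplus (c *: plus_coord x + plus_coord y) +
  vminus (c^* *: minus_coord x + minus_coord y).
Proof.
rewrite vplus_linear vminus_antilinear conjcK addrACA -scalerDr.
by rewrite -!plus_minus_coord.
Qed.

Lemma plus_coord_linear : linear plus_coord.
Proof. by move=> c x y; rewrite coordP plus_coordE. Qed.

Lemma minus_coord_antilinear : antilinear minus_coord.
Proof. by move=> c x y; rewrite coordP minus_coordE. Qed.

Lemma ip_cplxE x y : <<x | y>> =
  (complex.Re <<cre x | cre y>> + complex.Re <<cim x | cim y>>)
  +i* (complex.Re <<cre x | cim y>> - complex.Re <<cim x | cre y>>).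
Proof.
rewrite -[LHS]/(cplx_ip x y) /cplx_ip /Omega_C /= !OmegaNl !OmegaJ opprK.
by [].
Qed.

Let rrZ (z : R[i]) : r * (r * (z + z)) = z.
Proof.
by rewrite mulrA rr -[z + z]mulr2n -[z *+ 2]mulr_natl mulKf // pnatr_eq0.
Qed.

Lemma ip_vplus u v : <<vplus u | vplus v>> = <<u | v>>.
Proof.
rewrite ip_cplxE !vplusE -/r /= !(ipN, ipNl, ipZ, ipZl, conj_r).
(* Inserting [r * r * 2 = 1] on the right makes the identity polynomial in [r], within reach of
   [ring]. *)
rewrite -[RHS]rrZ /r; case: <<u | v>> => a b /=; congr (_ +i* _); ring.
Qed.

Lemma ip_vminus u v : <<vminus u | vminus v>> = <<v | u>>.
Proof.
rewrite ip_cplxE !vminusE -/r /= !(ipZ, ipZl, conj_r).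
rewrite [RHS]ip_conj -[RHS]rrZ /r; case: <<u | v>> => a b /=; congr (_ +i* _); ring.
Qed.

Lemma ip_vplus_vminus u v : <<vplus u | vminus v>> = 0.
Proof.
rewrite ip_cplxE vplusE vminusE -/r /= !(ipNl, ipZ, ipZl, conj_r).
rewrite /r; case: <<u | v>> => a b /=; congr (_ +i* _); ring.
Qed.

Lemma ip_vminus_vplus u v : <<vminus u | vplus v>> = 0.
Proof. by rewrite ip_conj ip_vplus_vminus rmorph0. Qed.

Lemma sym_plus1 : sym_plus (1 : sym V) = 1.
Proof.
have P (c : R[i]) u v : sym_in (vplus (c *: u + v)) =
    in_alg (sym (cplx V)) c * sym_in (vplus u) + sym_in (vplus v).
  by rewrite vplus_linear linearP mulr_algl.
by rewrite -[X in sym_plus X]scale1r /sym_plus (sym_extA P) rmorph1.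
Qed.

Lemma sym_minus1 : sym_minus (1 : sym V) = 1.
Proof.
have P (c : R[i]) u v : sym_in (vminus (c *: u + v)) =
    (in_alg (sym (cplx V)) \o @conjc R) c * sym_in (vminus u) + sym_in (vminus v).
  by rewrite vminus_antilinear linearP mulr_algl.
by rewrite -[X in sym_minus X]scale1r /sym_minus (sym_extA P) rmorph1.
Qed.

(** Since [vplus] is a linear isometry, its multiplicative extension intertwines the
    annihilators. *)
Lemma annihilator_plus_plus u s :
  annihilator (vplus u) (sym_plus s) = sym_plus (annihilator u s).
Proof.
have plus0 : sym_plus (0 : sym V) = 0.
  by rewrite -[X in sym_plus X](addNr 1) -scaleN1r sym_plus_linear scaleN1r addNr.
elim/sym_mul_ind: s => [|w s IH|c s t IHs IHt].
- by rewrite annihilator1 sym_plus1 annihilator1 plus0.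
- rewrite annihilator_in_mul sym_plus_linear !sym_plusM sym_plus_in.
  by rewrite annihilator_in_mul ip_vplus IH.
- by rewrite annihilator_linear !sym_plus_linear annihilator_linear IHs IHt.
Qed.

(** The conjugation in [ip_vminus] matches the antilinearity of [sym_minus]. *)
Lemma annihilator_minus_minus u s :
  annihilator (vminus u) (sym_minus s) = sym_minus (annihilator u s).
Proof.
elim/sym_mul_ind: s => [|w s IH|c s t IHs IHt].
- rewrite annihilator1 sym_minus1 annihilator1.
  by rewrite (antilinear0 (@sym_minus_antilinear R V)).
- rewrite annihilator_in_mul sym_minus_antilinear !sym_minusM sym_minus_in.
  by rewrite annihilator_in_mul ip_vminus -ip_conj IH.
- by rewrite annihilator_linear !sym_minus_antilinear annihilator_linear IHs IHt.
Qed.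

Lemma annihilator_plus_minus u s : annihilator (vplus u) (sym_minus s) = 0.
Proof.
elim/sym_mul_ind: s => [|w s IH|c s t IHs IHt].
- by rewrite sym_minus1 annihilator1.
- rewrite sym_minusM sym_minus_in annihilator_in_mul ip_vplus_vminus IH.
  by rewrite scale0r mulr0 addr0.
- by rewrite sym_minus_antilinear annihilator_linear IHs IHt scaler0 addr0.
Qed.

Lemma annihilator_minus_plus u s : annihilator (vminus u) (sym_plus s) = 0.
Proof.
elim/sym_mul_ind: s => [|w s IH|c s t IHs IHt].
- by rewrite sym_plus1 annihilator1.
- rewrite sym_plusM sym_plus_in annihilator_in_mul ip_vminus_vplus IH.
  by rewrite scale0r mulr0 addr0.
- by rewrite sym_plus_linear annihilator_linear IHs IHt scaler0 addr0.
Qed.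

Lemma annihilator_vplus u s t : annihilator (vplus u) (sym_plus s * sym_minus t) =
  sym_plus (annihilator u s) * sym_minus t.
Proof.
by rewrite annihilatorM annihilator_plus_plus annihilator_plus_minus mulr0 addr0.
Qed.

Lemma annihilator_vminus u s t : annihilator (vminus u) (sym_plus s * sym_minus t) =
  sym_plus s * sym_minus (annihilator u t).
Proof.
by rewrite annihilatorM annihilator_minus_plus annihilator_minus_minus mul0r add0r.
Qed.

End Polarization.

(** * Existence, uniqueness and symmetry of the kernel map *)

Section KernelMap.
Variables (R : realType) (V : hilbertType R) (g : V -> V).
Hypothesis hg : Sp g.
Let hh := inverse_Sp hg.

Lemma kernel_mapE Z x : kernel_map g Z -> Z x =
  vminus (inverse (C_ g) (plus_coord x)) + vplus (Z_ (inverse g) (plus_coord x)) +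
  (vplus (inverse (C_ (inverse g)) (minus_coord x)) + vminus (Z_ g (minus_coord x))).
Proof.
move=> [Za ZE]; rewrite {1}[x]plus_minus_coord (antilinearD Za).
by have [-> _] := ZE (plus_coord x); have [_ ->] := ZE (minus_coord x).
Qed.

(** The formula on [V_+] is antilinear in [v] and [plus_coord] is linear; the formula on [V_-] is
    linear and [minus_coord] antilinear. Both composites are therefore antilinear. *)
Lemma kernel_map_exists : exists Z, kernel_map g Z.
Proof.
pose Z1 v := vminus (inverse (C_ g) v) + vplus (Z_ (inverse g) v).
pose Z2 v := vplus (inverse (C_ (inverse g)) v) + vminus (Z_ g v).
have Z1P : antilinear Z1.
  move=> c u v; rewrite /Z1 inverse_C_linear // Z_antilinear //.
  by rewrite vplus_linear vminus_antilinear addrACA -scalerDr.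
have Z2P : linear Z2.
  move=> c u v; rewrite /Z2 inverse_C_linear // Z_antilinear //.
  by rewrite vplus_linear vminus_antilinear conjcK addrACA -scalerDr.
have Z10 := antilinear0 Z1P.
have Z20 : Z2 0 = 0 by rewrite -[X in Z2 X](addNr 0) -scaleN1r Z2P scaleN1r addNr.
exists (fun x => Z1 (plus_coord x) + Z2 (minus_coord x)); split.
  move=> c x y; rewrite plus_coord_linear minus_coord_antilinear Z1P Z2P.
  by rewrite addrACA -scalerDr.
have m0 := antilinear0 (@vminus_antilinear R V).
have p0 : vplus (0 : V) = 0.
  by rewrite -[X in vplus X](addNr 0) -scaleN1r vplus_linear scaleN1r addNr.
move=> v; split.
  by rewrite -[vplus v]addr0 -m0 plus_coordE minus_coordE Z20 addr0.
by rewrite -[vminus v]add0r -p0 plus_coordE minus_coordE Z10 add0r.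
Qed.

Lemma kernel_map_unique Z Z' : kernel_map g Z -> kernel_map g Z' -> Z = Z'.
Proof.
by move=> hZ hZ'; apply/funext => x; rewrite (kernel_mapE _ hZ) (kernel_mapE _ hZ').
Qed.

(** By orthogonality four pairings remain: those with [Z_] are symmetric one by one, and those with
    the inverses of [C_] are exchanged by [inverse_C_adj]. *)
Lemma kernel_map_symmetric Z : kernel_map g Z -> ip_symmetric Z.
Proof.
move=> hZ x y; rewrite !(kernel_mapE _ hZ).
set u := plus_coord x; set w := minus_coord x.
set u' := plus_coord y; set w' := minus_coord y.
rewrite {1}[y]plus_minus_coord {1}[x]plus_minus_coord -/u -/w -/u' -/w'.
rewrite !(ipD, ipDl) !(ip_vplus, ip_vminus, ip_vplus_vminus, ip_vminus_vplus).
rewrite !(add0r, addr0) !(inverse_C_adj hg u, inverse_C_adj hg u').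
rewrite (Z_symmetric hh u u') [<<Z_ g w | w'>>]ip_conj (Z_symmetric hg w w') -ip_conj.
by ring.
Qed.

End KernelMap.

(** * The intertwining relation *)

Section KernelOperator.
Variables (R : realType) (V : hilbertType R) (g : V -> V) (Z : cplx V -> cplx V).
Hypotheses (hg : Sp g) (hZ : kernel_map g Z).
Implicit Types (phi psi : sym V) (v : V).

Let Zs := kernel_map_symmetric hg hZ.
Let G_antidual := gaussian_antidual Zs.
Local Notation U := (kernel_operator (gaussian Z)).

Lemma kernel_operator_antidual phi : antidual (U phi).
Proof.
move=> c s t; rewrite /kernel_operator sym_plus_linear mulrDl -scalerAl.
exact: G_antidual.
Qed.

Lemma kernel_operator_linear c phi phi' psi :
  U (c *: phi + phi') psi = c * U phi psi + U phi' psi.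
Proof.
rewrite /kernel_operator sym_minus_antilinear mulrDr -scalerAr.
by rewrite (antidualP G_antidual) conjcK.
Qed.

Lemma kernel_operator_creator' v phi psi :
  U phi (creator v psi) =
  U (annihilator (inverse (C_ g) v) phi) psi + U phi (annihilator (Z_ (inverse g) v) psi).
Proof.
rewrite /kernel_operator /creator sym_plusM sym_plus_in -mulrA gaussian_in //.
have [_ /(_ v)[-> _]] := hZ; rewrite (antilinearD (annihilator_antilinear _)).
by rewrite (antidualD G_antidual) annihilator_vminus annihilator_vplus.
Qed.

Lemma kernel_operator_creator v phi psi :
  U (creator v phi) psi =
  U phi (annihilator (inverse (C_ (inverse g)) v) psi) + U (annihilator (Z_ g v) phi) psi.
Proof.
rewrite /kernel_operator /creator sym_minusM sym_minus_in mulrCA gaussian_in //.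
have [_ /(_ v)[_ ->]] := hZ; rewrite (antilinearD (annihilator_antilinear _)).
by rewrite (antidualD G_antidual) annihilator_vminus annihilator_vplus.
Qed.

Lemma kernel_operator_metaplectic : weak_metaplectic g U.
Proof.
have UD phi phi' psi : U (phi + phi') psi = U phi psi + U phi' psi.
  by rewrite -[phi]scale1r kernel_operator_linear mul1r scale1r.
have aD u v s : annihilator (u + v) s = annihilator u s + annihilator v s.
  exact: antilinearD (annihilator_antilinear s) u v.
split; [exact: kernel_operator_antidual|exact: kernel_operator_linear| |].
  exists 1, 1; rewrite /kernel_operator sym_plus1 sym_minus1 mulr1 gaussian1 //.
  exact: oner_neq0.
move=> v phi; apply/funext => psi; rewrite /pi_sym /pi_antidual /creator' /annihilator'.
rewrite -[X in U X]addr0 kernel_operator_linear.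
have -> : U 0 psi = 0.
  by apply: (addrI (U 0 psi)); rewrite -UD !addr0.
rewrite addr0 UD kernel_operator_creator kernel_operator_creator'.
(* This matches the terms where an annihilator acts on [phi]. Those where it acts on [psi] match
   below, by the same lemma for [inverse g] at [g v]. *)
rewrite inverse_C_g // aD UD; congr (_ * _).
have [_ /inverseK[gK _] _] := hg.
have := inverse_C_g (g v) (inverse_Sp hg); rewrite gK => ->.
by rewrite aD (antidualD (kernel_operator_antidual phi)); ring.
Qed.

End KernelOperator.

Theorem theorem7 (R : realType) (V : hilbertType R) (g : V -> V) (hg : Sp g) :
  (exists! Z : cplx V -> cplx V, kernel_map g Z) /\
  (forall Z : cplx V -> cplx V, kernel_map g Z ->
     ip_symmetric Z /\
     weak_metaplectic g (kernel_operator (gaussian Z))).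
Proof.
split; last first.
  move=> Z hZ; split; first exact: kernel_map_symmetric hZ.
  exact: kernel_operator_metaplectic.
have [Z hZ] := kernel_map_exists hg; exists Z; split=> // Z'.
exact: kernel_map_unique.
Qed.
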